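(* Let $l,u$ be integers with $0\le l\le u\le K$, $u>0$, $l<K$. Suppose that for every $\alpha,\beta\in(0,1)$ the thresholds $a,b,c,d$ of the proposed procedure $\hat\chi$ are chosen so that $\hat\chi\in\Delta(\alpha,\beta,\Pi_{l,u})$, and that $a,c\sim|\log\alpha|$ and $b,d\sim|\log\beta|$ as $\alpha,\beta\to0$. Suppose that for every $k\in[K]$ there are positive $I_k,J_k$ such that $$\mathrm P_k^1\Big(\limsup_n\tfrac{\lambda_k(n)}{n}\le I_k\Big)=1,\quad \mathrm P_k^0\Big(\limsup_n\tfrac{-\lambda_k(n)}{n}\le J_k\Big)=1,$$ and, for every $\epsilon>0$, $\sum_n\mathrm P_k^1(\lambda_k(n)/n\le I_k-\epsilon)<\infty$ and $\sum_n\mathrm P_k^0(-\lambda_k(n)/n\le J_k-\epsilon)<\infty$. Then, as $\alpha,\beta\to0$, $$\mathrm E_A[\hat T_i]\sim\mathcal L_{i,A}(\alpha,\beta,\Pi_{l,u})\sim\frac{|\log\alpha|}{I_i+\mathcal J_A\mathbf 1\{|A|=l\}},\qquad \mathrm E_A[\hat T_j]\sim\mathcal L_{j,A}(\alpha,\beta,\Pi_{l,u})\sim\frac{|\log\beta|}{J_j+\mathcal I_A\mathbf 1\{|A|=u\}},$$ simultaneously for every $i\in A$, $j\notin A$, $A\in\Pi_{l,u}$.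
   Context: Let $K\ge1$, $[K]=\{1,\dots,K\}$, $\mathbb N=\{1,2,\dots\}$. There are $K$ independent data streams $X_k=\{X_k(n):n\in\mathbb N\}$; $\mathcal F_k(n)=\sigma(X_k(t):t\le n)$, $\mathcal F(n)=\sigma(\mathcal F_k(n):k\in[K])$. For each $k$, $\mathrm P_k^0,\mathrm P_k^1$ are distributions of $X_k$ mutually absolutely continuous on each $\mathcal F_k(n)$, $\lambda_k(n)=\log\frac{d\mathrm P_k^1}{d\mathrm P_k^0}(\mathcal F_k(n))$. For $A\subseteq[K]$, $\mathrm P_A$ is the joint law with independent streams, $X_k\sim\mathrm P_k^1$ if $k\in A$, $\mathrm P_k^0$ otherwise; $\mathrm E_A$ its expectation. $\mathcal I_A=\min_{i\in A}I_i$, $\mathcal J_A=\min_{j\notin A}J_j$ (min over empty set $=\infty$). $\Pi_{l,u}=\{A\subseteq[K]:l\le|A|\le u\}$. $\lambda_{(1)}(n)\ge\dots\ge\lambda_{(K)}(n)$ are the ordered LLRs. A procedure $\chi=(\mathbf T,\mathbf D)$: $\mathbb N$-valued stopping times $T_k$ w.r.t. $\{\mathcal F(n)\}$ and $\mathcal F(T_k)$-measurable Bernoulli $D_k$. $\mathrm{FWE}^1_A(\chi)=\mathrm P_A(\exists j\notin A:D_j=1)$, $\mathrm{FWE}^2_A(\chi)=\mathrm P_A(\exists i\in A:D_i=0)$. $\Delta(\alpha,\beta,\Pi)$: procedures with $\mathrm{FWE}^1_A\le\alpha$, $\mathrm{FWE}^2_A\le\beta$ for all $A\in\Pi$; $\mathcal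 L_{k,A}(\alpha,\beta,\Pi)=\inf\{\mathrm E_A[T_k]:\chi\in\Delta(\alpha,\beta,\Pi)\}$. Proposed procedure $\hat\chi$ (thresholds $a,b,c,d>0$): $\hat T_k=\hat T_{k,1}\wedge\hat T_{k,2}$, $D_k=1$ iff $\hat T_k=\hat T_{k,1}$; if $l=u\equiv m$, $\hat T_{k,1}=\inf\{n:\lambda_k(n)\ge\lambda_{(m+1)}(n)+c\}$, $\hat T_{k,2}=\inf\{n:\lambda_k(n)\le\lambda_{(m)}(n)-d\}$; if $l<u$, $\hat T_{k,1}=\inf\{n:\lambda_k(n)\ge\min\{a,\lambda_{(l+1)}(n)+c\}\}$, $\hat T_{k,2}=\inf\{n:\lambda_k(n)\le\max\{-b,\lambda_{(u)}(n)-d\}\}$. $x\sim y$ means $x/y\to1$. *)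

(* Defs.v *)
From mathcomp Require Import all_boot all_order all_algebra.
From mathcomp Require Import all_classical all_reals all_analysis.
Set Implicit Arguments. Unset Strict Implicit. Unset Printing Implicit Defensive.
Import Order.TTheory GRing.Theory Num.Theory.
Local Open Scope classical_set_scope.
Local Open Scope ring_scope.

(* Time is indexed by nat; only times n >= 1 are meaningful (N = {1,2,...}).
   X k t : observation of stream k at time t (X k 0 is never used). *)

Definition gen_stream {d : measure_display} {Omega : measurableType d} {K : nat}
  {dS : 'I_K -> measure_display} {S : forall k, measurableType (dS k)}
  (X : forall k : 'I_K, nat -> Omega -> S k) (k : 'I_K) (n : nat) : set (set Omega) :=
  [set E | exists t, (1 <= t <= n)%N /\
     exists B : set (S k), measurable B /\ E = X k t @^-1` B].

Definition Fk {d : measure_display} {Omega : measurableType d} {K : nat}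
  {dS : 'I_K -> measure_display} {S : forall k, measurableType (dS k)}
  (X : forall k : 'I_K, nat -> Omega -> S k) (k : 'I_K) (n : nat) : set (set Omega) :=
  <<s gen_stream X k n >>.

Definition Fk_inf {d : measure_display} {Omega : measurableType d} {K : nat}
  {dS : 'I_K -> measure_display} {S : forall k, measurableType (dS k)}
  (X : forall k : 'I_K, nat -> Omega -> S k) (k : 'I_K) : set (set Omega) :=
  <<s \bigcup_n gen_stream X k n >>.

Definition Fn {d : measure_display} {Omega : measurableType d} {K : nat}
  {dS : 'I_K -> measure_display} {S : forall k, measurableType (dS k)}
  (X : forall k : 'I_K, nat -> Omega -> S k) (n : nat) : set (set Omega) :=
  <<s \bigcup_k gen_stream X k n >>.

Definition F_inf {d : measure_display} {Omega : measurableType d} {K : nat}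
  {dS : 'I_K -> measure_display} {S : forall k, measurableType (dS k)}
  (X : forall k : 'I_K, nat -> Omega -> S k) : set (set Omega) :=
  <<s \bigcup_k \bigcup_n gen_stream X k n >>.

(** Stopping times take values in N u {oo}: [Some n] = n, [None] = oo. *)
Definition otime {R : realType} (t : option nat) : \bar R :=
  if t is Some n then (n%:R)%:E else +oo%E.

Definition omin (s t : option nat) : option nat :=
  match s, t with
  | Some m, Some n => Some (minn m n)
  | Some m, None => Some m
  | None, _ => t
  end.

Definition first_hit (p : nat -> Prop) : option nat :=
  let M := [set n | (0 < n)%N /\ p n /\ forall m, (0 < m)%N -> p m -> (n <= m)%N] in
  if pselect (M !=set0) then Some (xget 0%N M) else None.

Definition stopping_time {d : measure_display} {Omega : measurableType d} {K : nat}
  {dS : 'I_K -> measure_display} {S : forall k, measurableType (dS k)}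
  (X : forall k : 'I_K, nat -> Omega -> S k) (T : Omega -> option nat) : Prop :=
  (forall w, T w <> Some 0%N) /\ forall n, Fn X n [set w | T w = Some n].

Definition is_procedure {d : measure_display} {Omega : measurableType d} {R : realType}
  {K : nat} {dS : 'I_K -> measure_display} {S : forall k, measurableType (dS k)}
  (X : forall k : 'I_K, nat -> Omega -> S k) (P : {set 'I_K} -> probability Omega R)
  (T : 'I_K -> Omega -> option nat) (D : 'I_K -> Omega -> bool) : Prop :=
  forall k,
    [/\ stopping_time X (T k),
        (forall A, P A [set w | T k w = None] = 0%E),
        (* D_k is F(T_k)-measurable *)
        F_inf X [set w | D k w] &
        (forall n, Fn X n [set w | T k w = Some n /\ D k w])].

Definition FWE1 {d : measure_display} {Omega : measurableType d} {R : realType} {K : nat}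
  (P : {set 'I_K} -> probability Omega R) (D : 'I_K -> Omega -> bool) (A : {set 'I_K}) : \bar R :=
  P A [set w | exists j, j \notin A /\ D j w].

Definition FWE2 {d : measure_display} {Omega : measurableType d} {R : realType} {K : nat}
  (P : {set 'I_K} -> probability Omega R) (D : 'I_K -> Omega -> bool) (A : {set 'I_K}) : \bar R :=
  P A [set w | exists i, i \in A /\ D i w = false].

Definition Pi_lu {K : nat} (l u : nat) (A : {set 'I_K}) : Prop := (l <= #|A| <= u)%N.

Definition Delta {d : measure_display} {Omega : measurableType d} {R : realType}
  {K : nat} {dS : 'I_K -> measure_display} {S : forall k, measurableType (dS k)}
  (X : forall k : 'I_K, nat -> Omega -> S k) (P : {set 'I_K} -> probability Omega R)
  (alpha beta : R) (Pi : {set 'I_K} -> Prop)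
  : set (('I_K -> Omega -> option nat) * ('I_K -> Omega -> bool)) :=
  [set chi | is_procedure X P chi.1 chi.2 /\
     forall A, Pi A -> (FWE1 P chi.2 A <= alpha%:E)%E /\ (FWE2 P chi.2 A <= beta%:E)%E].

Definition ET {d : measure_display} {Omega : measurableType d} {R : realType} {K : nat}
  (P : {set 'I_K} -> probability Omega R) (A : {set 'I_K}) (T : Omega -> option nat) : \bar R :=
  (\int[P A]_w otime (T w))%E.

Definition Lopt {d : measure_display} {Omega : measurableType d} {R : realType}
  {K : nat} {dS : 'I_K -> measure_display} {S : forall k, measurableType (dS k)}
  (X : forall k : 'I_K, nat -> Omega -> S k) (P : {set 'I_K} -> probability Omega R)
  (k : 'I_K) (A : {set 'I_K}) (alpha beta : R) (Pi : {set 'I_K} -> Prop) : \bar R :=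
  ereal_inf [set ET P A (chi.1 k) | chi in Delta X P alpha beta Pi].

(** m-th largest value (1-based) among v 0, ..., v (K-1): lambda_(m) *)
Definition ordstat {R : realType} {K : nat} (v : 'I_K -> R) (m : nat) : R :=
  nth 0 (sort (fun x y : R => y <= x) [seq v i | i <- enum 'I_K]) m.-1.

Definition cond1 {R : realType} {K : nat} {Omega : Type} (lam : 'I_K -> nat -> Omega -> R)
  (l u : nat) (a c : R) (k : 'I_K) (n : nat) (w : Omega) : Prop :=
  if l == u then lam k n w >= ordstat (fun i => lam i n w) l.+1 + c
  else lam k n w >= Num.min a (ordstat (fun i => lam i n w) l.+1 + c).

Definition cond2 {R : realType} {K : nat} {Omega : Type} (lam : 'I_K -> nat -> Omega -> R)
  (l u : nat) (b d : R) (k : 'I_K) (n : nat) (w : Omega) : Prop :=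
  if l == u then lam k n w <= ordstat (fun i => lam i n w) u - d
  else lam k n w <= Num.max (- b) (ordstat (fun i => lam i n w) u - d).

Definition hatT1 {R : realType} {K : nat} {Omega : Type} (lam : 'I_K -> nat -> Omega -> R)
  (l u : nat) (a c : R) (k : 'I_K) (w : Omega) : option nat :=
  first_hit (fun n => cond1 lam l u a c k n w).

Definition hatT2 {R : realType} {K : nat} {Omega : Type} (lam : 'I_K -> nat -> Omega -> R)
  (l u : nat) (b d : R) (k : 'I_K) (w : Omega) : option nat :=
  first_hit (fun n => cond2 lam l u b d k n w).

Definition hatT {R : realType} {K : nat} {Omega : Type} (lam : 'I_K -> nat -> Omega -> R)
  (l u : nat) (a b c d : R) (k : 'I_K) (w : Omega) : option nat :=
  omin (hatT1 lam l u a c k w) (hatT2 lam l u b d k w).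

Definition hatD {R : realType} {K : nat} {Omega : Type} (lam : 'I_K -> nat -> Omega -> R)
  (l u : nat) (a b c d : R) (k : 'I_K) (w : Omega) : bool :=
  hatT lam l u a b c d k w == hatT1 lam l u a c k w.

(** calI_A = min_{i in A} I_i, calJ_A = min_{j notin A} J_j (min of empty set = +oo) *)
Definition calI {R : realType} {K : nat} (I : 'I_K -> R) (A : {set 'I_K}) : \bar R :=
  ereal_inf [set (I i)%:E | i in [set i | i \in A]].
Definition calJ {R : realType} {K : nat} (J : 'I_K -> R) (A : {set 'I_K}) : \bar R :=
  ereal_inf [set (J j)%:E | j in [set j | j \notin A]].

(** f(alpha,beta) ~ g(alpha,beta) as alpha, beta -> 0 (jointly), for g > 0 near 0:
    for every eps > 0, eventually (1-eps) g <= f <= (1+eps) g, i.e. f/g -> 1. *)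
Definition sim0 {R : realType} (f : R -> R -> \bar R) (g : R -> R -> R) : Prop :=
  forall eps : R, 0 < eps -> exists delta : R, 0 < delta /\
    forall alpha beta : R, 0 < alpha < delta -> 0 < beta < delta ->
      (((1 - eps) * g alpha beta)%:E <= f alpha beta <= ((1 + eps) * g alpha beta)%:E)%E.

Definition sing {K : nat} (k : 'I_K) : {set 'I_K} := [set k]%SET.
Definition emptyK {K : nat} : {set 'I_K} := finset.set0.

(* Main.v *)
(* Lower bound.  Let [i \in A].  If [l < #|A|] then [A :\ i] is also a possible signal
   set, and if [#|A| = l] then so is [j |: A :\ i] for the [j \notin A] with the smallest
   [J j].  The log-likelihood ratio between [P A] and this alternative is [lam i],
   respectively [lam i - lam j], which under [P A] grows at rate [r = I i], respectively
   [r = I i + J j].  On the event that the ratio stays below [r (1 + s) N] up to time [N],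
   a correct decision about stream [i] before time [N] has [P A]-probability at most
   [exp (r (1 + s) N)] times its probability under the alternative, where it is an error
   and so costs at most [alpha].  Hence no admissible procedure stops before
   [(1 - eps) |ln alpha| / r] with more than negligible probability.

   Upper bound.  With high probability [lam i n], respectively [lam i n - lam j n] for all
   [j \notin A], exceeds [r (1 - s) n]; complete convergence makes the probabilities of the
   exceptional events summable in [n], and they do not depend on the thresholds.  Off these
   events the proposed procedure has stopped at every time [n] at which [r (1 - s) n] exceeds
   the threshold, so its expected time is [threshold / (r (1 - s)) + O(1)].

   The claims for [j \notin A] are the mirror image. *)

Require Import Defs.
From HB Require Import structures.
From mathcomp Require Import all_boot all_order all_algebra.
From mathcomp Require Import all_classical all_reals all_analysis.
From mathcomp Require Import measurable_realfun ring lra.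
Set Implicit Arguments.
Unset Strict Implicit.
Unset Printing Implicit Defensive.
Import Order.TTheory GRing.Theory Num.Theory.
Local Open Scope classical_set_scope.
Local Open Scope ring_scope.

(** * Measures with an exponential density *)

Section density_measure.
Context {d : measure_display} {T : measurableType d} {R : realType}.
Variables (Q : {measure set T -> \bar R}) (f : T -> R).
Hypothesis mf : measurable_fun setT f.

(** Made a measure in [E], so that uniqueness of measures on a generating pi-system can compare it
    with a law [P A]. *)
Definition exp_density (E : set T) : \bar R := (\int[Q]_(w in E) (expR (f w))%:E)%E.

Let mef : measurable_fun setT (EFin \o (fun w => expR (f w))).
Proof. by apply/measurable_EFinP; exact: measurableT_comp. Qed.

Let exp_density0 : exp_density set0 = 0%E.
Proof. exact: integral_set0. Qed.

Let exp_density_ge0 E : (0 <= exp_density E)%E.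
Proof. by apply: integral_ge0 => w _; rewrite lee_fin expR_ge0. Qed.

Let exp_density_sigma_additive : semi_sigma_additive exp_density.
Proof.
move=> F mF tF mUF; rewrite /exp_density ge0_integral_bigcup//=.
- by apply: is_cvg_ereal_nneg_natsum => n _; exact: exp_density_ge0.
exact: measurable_funTS.
Qed.

HB.instance Definition _ := isMeasure.Build _ _ _ exp_density
  exp_density0 exp_density_ge0 exp_density_sigma_additive.

End density_measure.

(** Each integral depends only on the image of the measure under [f]; the two measures may differ on
    all other events. *)
Lemma eq_integral_expR {d : measure_display} {T : measurableType d} {R : realType}
    (m1 m2 : {measure set T -> \bar R}) (f : T -> R) :
    measurable_fun setT f ->
    (forall B : set R, measurable B -> m1 (f @^-1` B) = m2 (f @^-1` B)) ->
  (\int[m1]_w (expR (f w))%:E = \int[m2]_w (expR (f w))%:E)%E.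
Proof.
move=> mf m12.
have mexp : measurable_fun setT (EFin \o @expR R).
  by apply/measurable_EFinP.
have tr (m : {measure set T -> \bar R}) :
    (\int[m]_w (expR (f w))%:E = \int[pushforward m f]_x (expR x)%:E)%E.
  rewrite (ge0_integral_pushforward mf)//.
rewrite !tr; apply: eq_measure_integral => B mB _.
exact: m12.
Qed.

(** * The filtrations of the streams *)

Section streams.
Context {d : measure_display} {Omega : measurableType d} {K : nat}.
Context {dS : 'I_K -> measure_display} {S : forall k, measurableType (dS k)}.
Variable X : forall k : 'I_K, nat -> Omega -> S k.

Lemma Fk_Fk_inf k n : Fk X k n `<=` Fk_inf X k.
Proof. by apply: sub_sigma_algebra2 => E GE; exists n. Qed.

Lemma Fk_Fn k n : Fk X k n `<=` Fn X n.
Proof. by apply: sub_sigma_algebra2 => E GE; exists k. Qed.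

Hypothesis mX : forall k t, measurable_fun setT (X k t).

Lemma gen_stream_measurable k n : gen_stream X k n `<=` measurable.
Proof.
move=> _ [t [_ [B [mB ->]]]]; rewrite -[X in measurable X]setTI.
exact: mX.
Qed.

Lemma Fk_inf_measurable k : Fk_inf X k `<=` measurable.
Proof.
apply: smallest_sub; first exact: sigma_algebra_measurable.
by move=> E [n _]; exact: gen_stream_measurable.
Qed.

Lemma Fk_measurable k n : Fk X k n `<=` measurable.
Proof. exact: subset_trans (@Fk_Fk_inf k n) (@Fk_inf_measurable k). Qed.

Lemma Fn_measurable n : Fn X n `<=` measurable.
Proof.
apply: smallest_sub; first exact: sigma_algebra_measurable.
by move=> E [k _]; exact: gen_stream_measurable.
Qed.

Lemma F_inf_measurable : F_inf X `<=` measurable.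
Proof.
apply: smallest_sub; first exact: sigma_algebra_measurable.
by move=> E [k _ [n _]]; exact: gen_stream_measurable.
Qed.

Lemma Fk_infI k A B : Fk_inf X k A -> Fk_inf X k B -> Fk_inf X k (A `&` B).
Proof. exact: (@measurableI _ (g_sigma_algebraType _)). Qed.

Lemma FkI k n A B : Fk X k n A -> Fk X k n B -> Fk X k n (A `&` B).
Proof. exact: (@measurableI _ (g_sigma_algebraType _)). Qed.

Lemma FnI n A B : Fn X n A -> Fn X n B -> Fn X n (A `&` B).
Proof. exact: (@measurableI _ (g_sigma_algebraType _)). Qed.

Lemma FnD n A B : Fn X n A -> Fn X n B -> Fn X n (A `\` B).
Proof. exact: (@measurableD _ (g_sigma_algebraType _)). Qed.

Lemma Fk_infT k : Fk_inf X k setT.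
Proof. exact: (@measurableT _ (g_sigma_algebraType _)). Qed.

Lemma FkT k n : Fk X k n setT.
Proof. exact: (@measurableT _ (g_sigma_algebraType _)). Qed.

(** One event per stream, up to time [n]: independence evaluates these events, and they form a
    pi-system generating [Fn X n]. *)
Definition rectangles n : set (set Omega) :=
  [set E | exists F : 'I_K -> set Omega, (forall k, Fk X k n (F k)) /\ E = \bigcap_k F k].

Lemma rectangles_setI n : setI_closed (rectangles n).
Proof.
move=> _ _ [F [mF ->]] [G [mG ->]]; exists (fun k => F k `&` G k); split.
  by move=> k; exact: FkI.
by rewrite bigcapI.
Qed.

Lemma rectanglesT n : rectangles n setT.
Proof.
exists (fun=> setT); split; first by move=> k; exact: FkT.
by apply/esym/seteqP; split.
Qed.

Lemma rectangles_Fn n : rectangles n `<=` Fn X n.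
Proof.
move=> _ [F [mF ->]].
apply: (@fin_bigcap_measurable _ (g_sigma_algebraType _)) => // k _.
exact: Fk_Fn (mF k).
Qed.

Lemma Fn_rectangles n : Fn X n `<=` <<s rectangles n >>.
Proof.
apply: sub_sigma_algebra2 => E [k _ GE].
exists (fun j => if j == k then E else setT); split.
  move=> j; case: eqP => [->|_]; last exact: FkT.
  exact: sub_sigma_algebra.
apply/seteqP; split=> [w Ew j _|w]; first by case: ifP.
by move=> /(_ k I); rewrite eqxx.
Qed.
End streams.

(** * Integrals of exponential densities over events *)

Lemma integral_expR_mrestr {d : measure_display} {T : measurableType d} {R : realType}
    (m : {measure set T -> \bar R}) (D : set T) (mD : measurable D) (f : T -> R) :
    measurable_fun setT f ->
  (\int[m]_(w in D) (expR (f w))%:E = \int[mrestr m mD]_w (expR (f w))%:E)%E.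
Proof.
move=> mf; have mef E : measurable_fun E (EFin \o (fun w => expR (f w))).
  by apply: measurable_funTS; apply/measurable_EFinP; exact: measurableT_comp.
rewrite -(setUv D) ge0_integral_setU//; last 2 first.
- exact: measurableC.
- exact/disj_setPCl.
rewrite [X in (_ + X)%E]null_set_integral ?adde0//.
- by apply: eq_measure_integral => A _ AD; rewrite /= /mrestr (setIidl AD).
- exact: measurableC.
- by rewrite /= /mrestr setICl.
Qed.

Lemma le_exp_density {d : measure_display} {T : measurableType d} {R : realType}
    (m : {measure set T -> \bar R}) (f g : T -> R) (x : R) (D : set T) :
    measurable D -> measurable_fun setT f -> measurable_fun setT g ->
    (forall w, D w -> f w <= x + g w) ->
  (exp_density m f D <= (expR x)%:E * exp_density m g D)%E.
Proof.
move=> mD mf mg fg; have mef h : measurable_fun setT h ->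
    measurable_fun D (EFin \o (fun w => expR (h w))).
  by move=> mh; apply: measurable_funTS; apply/measurable_EFinP; exact: measurableT_comp.
rewrite /exp_density -ge0_integralZl_EFin ?expR_ge0//; last exact: mef.
apply: ge0_le_integral => //.
- exact: mef.
- apply: measurable_funeM; exact: mef.
- by move=> w Dw; rewrite -EFinM lee_fin -expRD ler_expR fg.
Qed.

Lemma exp_density_0 {d : measure_display} {T : measurableType d} {R : realType}
    (m : {measure set T -> \bar R}) (D : set T) :
  measurable D -> exp_density m (fun=> 0) D = m D.
Proof. by move=> mD; rewrite /exp_density expR0 integral_cst// mul1e. Qed.

Lemma otime_measurable {d : measure_display} {Omega : measurableType d} {R : realType}
    (T : Omega -> option nat) :
    (forall n, measurable [set w | T w = Some n]) ->
  measurable_fun setT (fun w => otime (T w) : \bar R).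
Proof.
move=> mT _ B mB; rewrite setTI.
have mC (C : Prop) : measurable [set _ : Omega | C].
  case: (pselect C) => c.
    by rewrite (_ : [set _ | _] = setT)//; apply/seteqP; split.
  by rewrite (_ : [set _ | _] = set0)//; apply/seteqP; split.
have mTN : measurable [set w | T w = None].
  rewrite (_ : [set _ | _] = ~` \bigcup_n [set w | T w = Some n]).
    by apply: measurableC; exact: bigcupT_measurable.
  apply/seteqP; split=> [w /= Tw [n _ /=]|w /= nT]; first by rewrite Tw.
  case Tw : (T w) => [n|//].
  by case: nT; exists n.
rewrite (_ : _ @^-1` B = \bigcup_n ([set w | T w = Some n] `&` [set _ | B n%:R%:E])
    `|` ([set w | T w = None] `&` [set _ | B +oo%E])); last first.
  apply/seteqP; split=> [w /=|w].
    by case Tw : (T w) => [n|] /= Bw; [left; exists n|right].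
  by move=> [[n _ [/= -> //]]|[/= -> //]].
apply: measurableU; last exact: measurableI.
by apply: bigcupT_measurable => n; exact: measurableI.
Qed.

(** * Bounds on expected stopping times *)

Section stopping_lower_bound.
Context {d : measure_display} {Omega : measurableType d} {R : realType}.
Variables (Q Q' : probability Omega R) (G : nat -> set (set Omega)).
Variables (L : nat -> Omega -> R) (T : Omega -> option nat) (D : Omega -> bool).
Hypothesis mG : forall n, G n `<=` measurable.
Hypothesis T_gt0 : forall w, T w <> Some 0%N.
Hypothesis GT : forall n, G n [set w | T w = Some n].
Hypothesis GTD : forall n, G n [set w | T w = Some n /\ D w].
Hypothesis mD : measurable [set w | D w].
Hypothesis mL : forall n, (0 < n)%N -> measurable_fun setT (L n).
Hypothesis QQ' : forall n x E, (0 < n)%N -> G n E ->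
  (Q (E `&` [set w | (L n w <= x)%R]) <= (expR x)%:E * Q' E)%E.

Let early N := [set w | exists2 n, (n <= N)%N & T w = Some n].

Let early_measurable N : measurable (early N).
Proof.
rewrite (_ : early N = \bigcup_(n in `I_N.+1) [set w | T w = Some n]).
  by apply: fin_bigcup_measurable => // n _; exact: mG.
by apply/seteqP; split=> [w [n nN Tw]|w [n nN Tw]]; exists n.
Qed.

(** On an early stop [D] fails, or [Bad] occurs, or [T] stops at some [n <= N] with [D] true and
    [L n] at most [x]. In the last case [QQ'] passes to [Q'] at the price [expR x]; the events are
    disjoint in [n], so their sum stays below [Q'] of [D]. *)
Lemma early_stop_prob N x (Bad : set Omega) : measurable Bad ->
    (forall w n, ~ Bad w -> (0 < n <= N)%N -> L n w <= x) ->
  (Q (early N) <= Q (~` [set w | D w]) + Q Bad + (expR x)%:E * Q' [set w | D w])%E.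
Proof.
move=> mBad LBad.
pose F n := [set w | T w = Some n /\ D w].
have mF n : measurable (F n) by exact: (mG (GTD n)).
have tF : trivIset setT F.
  by move=> m n _ _ [w [[Tm _] [Tn _]]]; move: Tn; rewrite Tm => -[].
(* The condition [0 < n] empties the piece at time 0, where [mL] and [QQ'] say nothing. *)
pose H n := F n `&` [set w | (0 < n)%N /\ L n w <= x].
have mH n : measurable (H n).
  rewrite /H; case: (posnP n) => [->|n0].
    by rewrite (_ : [set _ | _] = set0) ?setI0//; apply/seteqP; split=> // w [].
  rewrite (_ : [set w | _ /\ _] = setT `&` L n @^-1` `]-oo, x]).
    by apply: measurableI => //; apply: mL.
  by apply/seteqP; split=> w /=; rewrite in_itv /= => -[].
have HF n : (Q (H n) <= (expR x)%:E * Q' (F n))%E.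
  case: (posnP n) => [n0|n0].
    rewrite /H (_ : [set _ | _] = set0) ?setI0 ?measure0.
      by rewrite mule_ge0// lee_fin expR_ge0.
    by apply/seteqP; split=> // w []; rewrite n0.
  rewrite /H (_ : [set w | _ /\ _] = [set w | L n w <= x]); first exact: QQ'.
  by apply/seteqP; split=> w //= [].
have sub : early N `<=` ~` [set w | D w] `|` Bad `|` \big[setU/set0]_(n < N.+1) H n.
  move=> w [n nN Tw]; case: (pselect (Bad w)) => [Bw|nBw]; first by left; right.
  case: (boolP (D w)) => [Dw|/negP nDw]; last by left; left.
  right; rewrite -bigcup_mkord; exists n => //; split=> //.
  have n0 : (0 < n)%N by case: n Tw {nN} => // /T_gt0.
  by split=> //; apply: LBad => //; rewrite n0.
have mDC : measurable (~` [set w | D w]) by exact: measurableC.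
have mUH : measurable (\big[setU/set0]_(n < N.+1) H n) by exact: bigsetU_measurable.
apply: (le_trans (le_measure Q _ _ sub)); rewrite ?inE//.
  by apply: measurableU => //; exact: measurableU.
apply: (le_trans (measureU2 _ _ _)) => //; first exact: measurableU.
apply: leeD; first exact: measureU2.
apply: (@le_trans _ _ (\sum_(n < N.+1) Q (H n))%E).
  exact: Boole_inequality.
apply: (@le_trans _ _ (\sum_(n < N.+1) (expR x)%:E * Q' (F n))%E).
  by apply: lee_sum => n _; exact: HF.
rewrite -ge0_sume_distrr//.
rewrite -measure_bigsetU//; apply: lee_wpmul2l; first by rewrite lee_fin expR_ge0.
apply: le_measure; rewrite ?inE//; first exact: bigsetU_measurable.
by rewrite -bigcup_mkord => w [n _ []].
Qed.

(** Markov's inequality: off [early N] the time exceeds [N], and [early_stop_prob] bounds the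
    probability of [early N] by [p + eta + expR x * q]. *)
Lemma expected_time_lower N x (Bad : set Omega) (eta p q : R) : measurable Bad ->
    (forall w n, ~ Bad w -> (0 < n <= N)%N -> L n w <= x) ->
    (Q (~` [set w | D w]) <= p%:E)%E -> (Q Bad <= eta%:E)%E ->
    (Q' [set w | D w] <= q%:E)%E ->
  ((N%:R * (1 - (p + eta + expR x * q)))%:E <= \int[Q]_w otime (T w))%E.
Proof.
move=> mBad LBad Qp Qeta Q'q.
have Qe : (Q (early N) <= (p + eta + expR x * q)%:E)%E.
  apply: (le_trans (early_stop_prob mBad LBad)).
  rewrite !EFinD EFinM; apply: leeD; first exact: leeD.
  by apply: lee_wpmul2l => //; rewrite lee_fin expR_ge0.
have mot : measurable_fun setT (fun w => otime (T w) : \bar R).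
  by apply: otime_measurable => n; exact: (mG (GT n)).
have ot0 w : (0 <= otime (T w) :> \bar R)%E by case: (T w) => //= n; rewrite lee_fin.
have mlate : measurable (~` early N) by exact: measurableC.
apply: (@le_trans _ _ (\int[Q]_(w in ~` early N) N%:R%:E)%E).
  have QC : Q (~` early N) = (1 - Q (early N))%E by exact: probability_setC.
  rewrite integral_cst//= QC EFinM.
  apply: lee_wpmul2l; first by rewrite lee_fin.
  by rewrite EFinB; apply: leeB.
apply: (@le_trans _ _ (\int[Q]_(w in ~` early N) otime (T w))%E); last first.
  by apply: ge0_subset_integral.
apply: ge0_le_integral => //; first exact: measurable_funTS.
move=> w /= nE; case Tw : (T w) => [n|]; last by rewrite leey.
by rewrite lee_fin ler_nat leqNgt; apply/negP => nN; apply: nE; exists n => //; exact: ltnW.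
Qed.
End stopping_lower_bound.

(** For [n >= N], not having stopped by time [n.+1] forces [B n]. So [T] is at most [N.+1] plus the
    number of [n] for which [B n] occurs, and this is integrated. *)
Lemma expected_time_upper {d : measure_display} {Omega : measurableType d} {R : realType}
    (Q : probability Omega R) (T : Omega -> option nat) (B : nat -> set Omega) (N : nat) :
    (forall n, measurable [set w | T w = Some n]) -> (forall n, measurable (B n)) ->
    (forall w n, (N <= n)%N -> ~ B n w -> exists2 m, T w = Some m & (m <= n.+1)%N) ->
  (\int[Q]_w otime (T w) <= N.+1%:R%:E + \sum_(0 <= n <oo) Q (B n))%E.
Proof.
move=> mT mB TB.
pose s w : \bar R := (\sum_(0 <= n <oo) (\1_(B n) w)%:E)%E.
have ind0 n w : (0 <= (\1_(B n) w)%:E :> \bar R)%E by rewrite lee_fin.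
have s0 w : (0 <= s w)%E by exact: nneseries_ge0.
(* If [T w] is [None], the premise holds for every [p], which makes the right-hand side infinite. *)
have psum w p : (forall m, T w = Some m -> p <= m)%N ->
    (p%:R%:E <= N.+1%:R%:E + s w)%E.
  move=> pT; have key q : (q < p)%N ->
      q%:R <= N%:R + \sum_(0 <= n < q) \1_(B n) w :> R.
    elim: q => [_|q IH qp]; first by rewrite big_nil addr0.
    have [qN|Nq] := ltnP q N.
      apply: (@le_trans _ _ N%:R); first by rewrite ler_nat.
      by rewrite lerDl sumr_ge0.
    rewrite big_nat_recr//= addrA -natr1 lerD ?IH//; first exact: ltnW.
    rewrite indicE mem_set// ; apply: contrapT => nB.
    have [m Tm mq] := TB w q Nq nB.
    by have := pT m Tm; rewrite leqNgt (leq_ltn_trans mq).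
  case: p pT key => [|p] pT key.
    by rewrite adde_ge0// lee_fin.
  rewrite -!natr1 !EFinD addeAC; apply: leeD => //.
  apply: (@le_trans _ _ (N%:R%:E + \sum_(0 <= n < p) (\1_(B n) w)%:E)%E).
    by rewrite sumEFin -EFinD lee_fin key.
  by apply: leeD => //; exact: nneseries_lim_ge.
have ots w : (otime (T w) <= N.+1%:R%:E + s w)%E.
  case Tw : (T w) => [n|] /=.
    by apply: psum => m; rewrite Tw => -[->].
  rewrite leye_eq; apply/eqP/eq_infty => x.
  apply: (@le_trans _ _ (Num.bound `|x|)%:R%:E).
    by rewrite lee_fin (le_trans (ler_norm x))// ltW// archi_boundP.
  by apply: psum => m; rewrite Tw.
have mind n : measurable_fun setT (EFin \o \1_(B n) : Omega -> \bar R).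
  by apply/measurable_EFinP; exact: measurable_indic.
have ms : measurable_fun setT s.
  by apply: ge0_emeasurable_sum => n // _; exact: mind.
apply: (@le_trans _ _ (\int[Q]_w (N.+1%:R%:E + s w))%E).
  apply: ge0_le_integral => //.
  - by move=> w _; case: (T w) => //= n; rewrite lee_fin.
  - exact: otime_measurable.
  - exact: emeasurable_funD.
rewrite ge0_integralD//.
rewrite integral_cst//= probability_setT mule1; apply: leeD => //.
rewrite integral_nneseries//.
by apply: lee_nneseries => // n _; rewrite ?integral_indic ?setIT ?measure_ge0.
Qed.

(** * Order statistics and sets of given size *)

Section order_statistics.
Context {R : realType} {K : nat}.
Variable v : 'I_K -> R.

Let s := sort (fun x y : R => y <= x) [seq v i | i <- enum 'I_K].

Let size_s : size s = K.
Proof. by rewrite size_sort size_map size_enum_ord. Qed.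

Let s_nonincreasing i j : (i <= j < K)%N -> nth 0 s j <= nth 0 s i.
Proof.
move=> /andP[ij jK].
have ss : sorted (fun x y : R => y <= x) s by apply: sort_sorted => x y; exact: le_total.
apply: (sorted_leq_nth _ _ 0 ss) => //; rewrite ?inE ?size_s//.
- by move=> x y z /= xy yz; exact: le_trans yz xy.
- exact: leq_ltn_trans ij jK.
Qed.

Let count_s (p : pred R) : count p s = #|[set i | p (v i)]%SET|.
Proof.
rewrite (permP (permEl (perm_sort _ _))) count_map cardE {2}/enum_mem size_filter enumT.
by apply: eq_count => i; rewrite /= !inE.
Qed.

(** Pigeonhole: at least [#|A|.+1] indices have a value reaching the order statistic, and they
    cannot all belong to [A]. *)
Lemma ordstat_succ_card (A : {set 'I_K}) : (#|A| < K)%N ->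
  exists2 j, j \notin A & ordstat v #|A|.+1 <= v j.
Proof.
move=> AK; set x := ordstat _ _.
case: (boolP [exists j, (j \notin A) && (x <= v j)]) => [/existsP[j /andP[]]|]; first by exists j.
rewrite negb_exists => /forallP H.
have sub : [set i | x <= v i]%SET \subset A.
  by apply/fintype.subsetP => i; rewrite inE => xi; have := H i; rewrite xi andbT negbK.
have := subset_leq_card sub; rewrite -(count_s (fun y => x <= y)).
rewrite -(cat_take_drop #|A|.+1 s) count_cat.
have -> : count (fun y => x <= y) (take #|A|.+1 s) = #|A|.+1.
  have sz : size (take #|A|.+1 s) = #|A|.+1 by rewrite size_takel// size_s.
  rewrite -[RHS]sz; apply/eqP; rewrite -all_count; apply/(all_nthP 0) => i.
  by rewrite sz => iA; rewrite nth_take//; apply: s_nonincreasing; rewrite -ltnS iA.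
by rewrite leqNgt ltnS leq_addr.
Qed.

(** Fewer than [#|A|] indices have a value strictly above the order statistic, so they cannot
    exhaust [A]. *)
Lemma ordstat_card (A : {set 'I_K}) : (0 < #|A|)%N ->
  exists2 i, i \in A & v i <= ordstat v #|A|.
Proof.
move=> A0; set x := ordstat _ _.
have AK : (#|A| <= K)%N by rewrite -[leqRHS]card_ord max_card.
case: (boolP [exists i, (i \in A) && (v i <= x)]) => [/existsP[j /andP[]]|]; first by exists j.
rewrite negb_exists => /forallP H.
have sub : A \subset [set i | x < v i]%SET.
  by apply/fintype.subsetP => i iA; rewrite inE; have := H i; rewrite iA /= -ltNge.
have := subset_leq_card sub; rewrite -(count_s (fun y => x < y)).
rewrite -(cat_take_drop #|A|.-1 s) count_cat.
have -> : count (fun y => x < y) (drop #|A|.-1 s) = 0%N.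
  apply/eqP; rewrite -leqn0 leqNgt -has_count; apply/(has_nthP 0) => -[i].
  rewrite size_drop size_s nth_drop => iA; apply/negP; rewrite -leNgt.
  by apply: s_nonincreasing; rewrite leq_addr/= -ltn_subRL.
rewrite addn0 => /leq_trans/(_ (count_size _ _)).
by rewrite size_takel ?size_s ?(leq_trans (leq_pred _))// -ltnS prednK// ltnn.
Qed.
End order_statistics.

(** * Crossing of linear boundaries *)

Lemma measure_bigsetU_le {d : measure_display} {T : measurableType d} {R : realType}
    (m : {measure set T -> \bar R}) (n : nat) (F : 'I_n -> set T) :
    (forall k, measurable (F k)) ->
  (m (\big[setU/set0]_(k < n) F k) <= \sum_(k < n) m (F k))%E.
Proof.
move=> mF.
have [] : measurable (\big[setU/set0]_(k < n) F k) /\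
    (m (\big[setU/set0]_(k < n) F k) <= \sum_(k < n) m (F k))%E; last by [].
elim/big_ind2 : _ => [|E x G y [mE Ex] [mG Gy]|k _]; last by split.
  by rewrite measure0; split.
split; first exact: measurableU.
by apply: (le_trans (measureU2 _ mE mG)); exact: leeD.
Qed.

(* The boundary is flat up to time [m]: staying below it bounds [Y n] by [r * N] for all
   [n <= N] as soon as [m <= N]. *)
Definition overshoot {Omega : Type} {R : realType} (Y : nat -> Omega -> R) (r : R) (m : nat) :
  set Omega := [set w | exists n, (0 < n)%N /\ r * (maxn n m)%:R < Y n w].

Lemma overshoot_bigcup {Omega : Type} {R : realType} (Y : nat -> Omega -> R) r m :
  overshoot Y r m = \bigcup_n (Y n.+1 @^-1` `]r * (maxn n.+1 m)%:R, +oo[).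
Proof.
apply/seteqP; split=> [w [[|n] [n0 Yn]]|w [n _]] //.
  by exists n => //=; rewrite in_itv /= Yn.
by rewrite /= in_itv /= andbT => Yn; exists n.+1.
Qed.

(** Beyond some [N] the gap [r < r'] gives [y n <= r' * n]; the finitely many earlier values are
    dominated by [b], and [m] is taken so large that [r' * m >= b]. *)
Lemma overshoot_eventually {R : realType} (y : nat -> R) (r r' : R) : 0 < r -> r < r' ->
    (limn_esup (fun n => (y n.+1 / n.+1%:R)%:E) <= r%:E)%E ->
  exists m, forall n, (0 < n)%N -> y n <= r' * (maxn n m)%:R.
Proof.
move=> r0 rr' lim_le; have r'0 : 0 < r' by exact: lt_trans rr'.
have : (limn_esup (fun n => (y n.+1 / n.+1%:R)%:E) < r'%:E)%E.
  by apply: le_lt_trans lim_le _; rewrite lte_fin.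
move=> /ereal_inf_lt[_ [V [N _ NV] <-] supV].
pose b : R := \sum_(n < N.+1) `|y n|.
have b0 : 0 <= b / r' by rewrite divr_ge0 ?sumr_ge0// ltW.
exists (Num.bound (b / r')) => n n0.
have [nN|Nn] := leqP n N.
  apply: (@le_trans _ _ b).
    rewrite /b (bigD1 (Ordinal (nN : (n < N.+1)%N)))//=.
    by rewrite (le_trans (ler_norm _))// lerDl sumr_ge0.
  rewrite mulrC -ler_pdivrMr// (le_trans (ltW (archi_boundP b0)))//.
  by rewrite ler_nat leq_maxr.
apply: (@le_trans _ _ (r' * n%:R)); last by rewrite ler_pM2l// ler_nat leq_maxl.
case: n n0 Nn => // n _ Nn.
rewrite -ler_pdivrMr// -lee_fin (le_trans _ (ltW supV))//.
by apply: ereal_sup_ubound; exists n => //; exact: NV.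
Qed.

(** The complements of the overshoot events increase in [m] and their union contains the limsup
    event, which has probability one; continuity from below concludes. *)
Lemma overshoot_vanish {d : measure_display} {Omega : measurableType d} {R : realType}
    (Q : probability Omega R) (Y : nat -> Omega -> R) (r r' eta : R) :
    (forall n, (0 < n)%N -> measurable_fun setT (Y n)) ->
    Q [set w | (limn_esup (fun n => (Y n.+1 w / n.+1%:R)%:E) <= r%:E)%E] = 1%E ->
    0 < r -> r < r' -> 0 < eta ->
  exists m, (Q (overshoot Y r' m) <= eta%:E)%E.
Proof.
move=> mY Qlim r0 rr' eta0.
have mO m : measurable (overshoot Y r' m).
  rewrite overshoot_bigcup; apply: bigcupT_measurable => n.
  by rewrite -[X in measurable X]setTI; exact: mY.
pose F m := ~` overshoot Y r' m.
have mF m : measurable (F m) by exact: measurableC.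
have mUF : measurable (\bigcup_m F m) by exact: bigcupT_measurable.
have ndF : nondecreasing_seq F.
  move=> m1 m2 m12; apply/subsetPset => w nO [n [n0 Yn]]; apply: nO; exists n; split=> //.
  apply: le_lt_trans Yn; rewrite ler_pM2l ?(lt_trans r0)// ler_nat.
  by rewrite geq_max leq_maxl leq_max m12 orbT.
have mlim : measurable [set w | (limn_esup (fun n => (Y n.+1 w / n.+1%:R)%:E) <= r%:E)%E].
  have : measurable_fun setT (fun w => limn_esup (fun n => (Y n.+1 w / n.+1%:R)%:E)).
    apply: measurable_fun_limn_esup => n; apply/measurable_EFinP.
    by apply: measurable_funM => //; exact: mY.
  move=> /(_ measurableT `]-oo, r%:E]%classic); rewrite setTI => /(_ (emeasurable_itv _)).
  by congr measurable; apply/seteqP; split=> w /=; rewrite in_itv.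
have QUF : Q (\bigcup_m F m) = 1%E.
  apply/eqP; rewrite eq_le probability_le1//= -Qlim le_measure ?inE//.
  move=> w /= wlim; have [m ym] := @overshoot_eventually _ (Y ^~ w) _ _ r0 rr' wlim.
  by exists m => // -[n [n0]]; rewrite ltNge ym.
have QF : Q \o F @ \oo --> 1%E by rewrite -QUF; exact: nondecreasing_cvg_mu.
have : ereal_nbhs 1%E (fun u : \bar R => ((1 - eta)%:E < u)%E).
  by apply: open_ereal_gt'; rewrite lte_fin ltrBlDr ltrDl.
move=> /QF[m _ /(_ m (leqnn m)) /= Qm]; exists m.
have := probability_setC Q (mO m); rewrite -/(F m) => QFm.
move: Qm; rewrite QFm.
have : Q (overshoot Y r' m) \is a fin_num by exact: fin_num_measure.
case: (Q (overshoot Y r' m)) => //= q _; rewrite -EFinB lte_fin lee_fin => Hq.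
by move: Hq; rewrite ltrD2l ltrN2 => /ltW.
Qed.

Lemma ereal_inf_min {R : realType} {K : nat} (f : 'I_K -> R) (p : pred 'I_K) k0 : p k0 ->
  exists k, [/\ p k, ereal_inf [set (f i)%:E | i in [set i | p i]] = (f k)%:E &
    forall i, p i -> f k <= f i].
Proof.
move=> pk0; case: (@arg_minP _ _ _ k0 p f pk0) => k pk kmin.
exists k; split=> //; apply/eqP; rewrite eq_le; apply/andP; split.
  by apply: ereal_inf_lbound; exists k.
by apply/ereal_infP => _ [i /= pi <-]; rewrite lee_fin kmin.
Qed.

(** * Single-stream errors inside family-wise errors *)

Section error_probabilities.
Context {d : measure_display} {Omega : measurableType d} {R : realType} {K : nat}.
Variables (P : {set 'I_K} -> probability Omega R) (D : 'I_K -> Omega -> bool).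
Hypothesis mD : forall k, measurable [set w | D k w].

Lemma FWE1_ge (A : {set 'I_K}) j : j \notin A -> (P A [set w | D j w] <= FWE1 P D A)%E.
Proof.
move=> jA; apply: le_measure; rewrite ?inE//; last by move=> w Dw; exists j.
rewrite (_ : [set w | _] = \bigcup_(j in [set j | j \notin A]) [set w | D j w]).
  by apply: fin_bigcup_measurable.
by apply/seteqP; split=> w; [move=> [k [kA Dk]]; exists k|move=> [k kA Dk]; exists k].
Qed.

Lemma FWE2_ge (A : {set 'I_K}) i : i \in A -> (P A (~` [set w | D i w]) <= FWE2 P D A)%E.
Proof.
move=> iA; apply: le_measure; rewrite ?inE//; first exact: measurableC.
  rewrite (_ : [set w | _] = \bigcup_(i in [set i | i \in A]) ~` [set w | D i w]).
    by apply: fin_bigcup_measurable => // k _; exact: measurableC.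
  apply/seteqP; split=> w; [move=> [k [kA Dk]]|move=> [k kA /negP Dk]]; exists k => //=.
    by rewrite Dk.
  by split=> //; exact: negbTE.
by move=> w /= /negP Dw; exists i; split=> //; exact: negbTE.
Qed.
End error_probabilities.

(** * The proposed procedure *)

Lemma first_hit_le (p : nat -> Prop) n : (0 < n)%N -> p n ->
  exists2 m, first_hit p = Some m & (m <= n)%N.
Proof.
move=> n0 pn; rewrite /first_hit /=.
set M := [set n | _].
have M0 : M !=set0.
  have ex : exists m, (0 < m)%N && `[< p m >] by exists n; rewrite n0; apply/asboolP.
  case: (ex_minnP ex) => m /andP[m0 /asboolP pm] mmin.
  by exists m; do ![split=> //] => k k0 pk; apply: mmin; rewrite k0; apply/asboolP.
case: (pselect (M !=set0)) => [M1|//]; exists (xget 0%N M) => //.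
by have [_ [_ /(_ n n0 pn)]] := xgetPex 0%N M0.
Qed.

Lemma hatT_le {R : realType} {K : nat} {Omega : Type} (lam : 'I_K -> nat -> Omega -> R)
    l u a b c d k w n : (0 < n)%N ->
    cond1 lam l u a c k n w \/ cond2 lam l u b d k n w ->
  exists2 m, hatT lam l u a b c d k w = Some m & (m <= n)%N.
Proof.
rewrite /hatT => n0 [H1|H2].
  have [m Tm mn] := @first_hit_le (fun n => cond1 lam l u a c k n w) n n0 H1.
  rewrite /hatT1 Tm; case: (hatT2 _ _ _ _ _ _ _) => [m'|] /=; last by exists m.
  by exists (minn m m') => //; rewrite geq_min mn.
have [m Tm mn] := @first_hit_le (fun n => cond2 lam l u b d k n w) n n0 H2.
rewrite /hatT2 Tm; case: (hatT1 _ _ _ _ _ _ _) => [m'|] /=; last by exists m.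
by exists (minn m' m) => //; rewrite geq_min mn orbT.
Qed.

(** If [#|A| = l], some [j \notin A] has a ratio at least the [l.+1]-st largest, so beating every
    such [j] by [c] beats the order statistic. Otherwise [l < u], and passing [a] alone suffices. *)
Lemma cond1_in {R : realType} {K : nat} {Omega : Type} (lam : 'I_K -> nat -> Omega -> R)
    l u a c (A : {set 'I_K}) i n w : (l < K)%N -> Pi_lu l u A ->
    (if #|A| == l then forall j, j \notin A -> lam j n w + c <= lam i n w
     else a <= lam i n w) ->
  cond1 lam l u a c i n w.
Proof.
move=> lK /andP[lA Au]; rewrite /cond1; case: eqP => [Al lamc|Al alam].
  have AK : (#|A| < K)%N by rewrite Al.
  have [j jA] := ordstat_succ_card (fun k => lam k n w) AK; rewrite Al => oj.
  have H : ordstat (fun k => lam k n w) l.+1 + c <= lam i n w.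
    by apply: le_trans (lamc j jA); rewrite lerD2r.
  by case: ifP => // _; rewrite ge_min H orbT.
case: eqP => [lu|_]; last by rewrite ge_min alam.
by exfalso; apply: Al; apply/eqP; rewrite eqn_leq lA lu Au.
Qed.

(** Dual of [cond1_in]: when [#|A| = u], some [i \in A] has a ratio at most the [u]-th largest. *)
Lemma cond2_out {R : realType} {K : nat} {Omega : Type} (lam : 'I_K -> nat -> Omega -> R)
    l u b d (A : {set 'I_K}) j n w : (0 < u)%N -> Pi_lu l u A ->
    (if #|A| == u then forall i, i \in A -> lam j n w <= lam i n w - d
     else b <= - lam j n w) ->
  cond2 lam l u b d j n w.
Proof.
move=> u0 /andP[lA Au]; rewrite /cond2; case: eqP => [uA lamd|nuA blam].
  have A0 : (0 < #|A|)%N by rewrite uA.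
  have [i iA] := ordstat_card (fun k => lam k n w) A0; rewrite uA => oi.
  have H : lam j n w <= ordstat (fun k => lam k n w) u - d.
    by apply: le_trans (lamd i iA) _; rewrite lerD2r.
  by case: ifP => // _; rewrite le_max H orbT.
case: eqP => [lu|_]; last by rewrite le_max lerNr blam.
by exfalso; apply: nuA; apply/eqP; rewrite eqn_leq Au -lu lA.
Qed.

(** * First-order asymptotics *)

Lemma sim0_swap {R : realType} (f : R -> R -> \bar R) (g : R -> R -> R) :
  sim0 f g -> sim0 (fun x y => f y x) (fun x y => g y x).
Proof.
move=> fg eps eps0; have [delta [delta0 H]] := fg eps eps0.
by exists delta; split=> // x y x0 y0; exact: H.
Qed.

Lemma ln_near0 {R : realType} (H x : R) : 0 < x < expR (- H) -> x < 1 ->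
  [/\ H < `|ln x|, `|ln x| = - ln x & x = expR (- `|ln x|)].
Proof.
move=> /andP[x0 xH] x1.
have lnx : `|ln x| = - ln x by rewrite ltr0_norm// ln_lt0// x0 x1.
rewrite lnx opprK lnK ?posrE//; split=> //.
by rewrite ltrNr -ltr_expR lnK ?posrE.
Qed.

(* [x] is the error level that drives the growth of the expected time and [y] the other one;
   for the streams outside of [A] this is the opposite of the order of [alpha] and [beta]. *)
Section asymptotics.
Context {R : realType}.
Variables (r : R) (thr : R -> R -> R) (Lo Hi : R -> R -> \bar R).
Hypothesis r_gt0 : 0 < r.
Hypothesis Lo_ge : forall s eta : R, 0 < s -> 0 < eta -> exists m, forall N, (m <= N)%N ->
  forall x y : R, 0 < x < 1 -> 0 < y < 1 ->
    ((N%:R * (1 - (y + eta + expR (r * (1 + s) * N%:R) * x)))%:E <= Lo x y)%E.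
Hypothesis Hi_le : forall s : R, 0 < s < 1 -> exists C : R, forall N x y,
  0 < x < 1 -> 0 < y < 1 -> thr x y <= r * (1 - s) * N%:R ->
    (Hi x y <= (N.+1%:R + C)%:E)%E.
Hypothesis LoHi : forall x y, 0 < x < 1 -> 0 < y < 1 -> (Lo x y <= Hi x y)%E.
Hypothesis thr_sim : sim0 (fun x y => (thr x y)%:E) (fun x y => `|ln x|).

(** The restriction on [eps] keeps [eta] below 1 and [1 - 2 * s] positive; [asymptotic_lower]
    removes it by shrinking [eps], which only strengthens the bound. *)
Let asymptotic_lower_small (eps : R) : 0 < eps <= 2^-1 -> exists delta, 0 < delta < 1 /\
  forall x y, 0 < x < delta -> 0 < y < delta ->
    (((1 - eps) * (`|ln x| / r))%:E <= Lo x y)%E.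
Proof.
move=> /andP[eps0 eps2].
(* Since [(1 + s) (1 - 2 s) < 1 - s], at [N ~ (1 - 2 s) |ln x| / r] the term
   [expR (r (1 + s) N) * x] is at most [x `^ s], which vanishes. *)
pose s := eps / 8; pose eta := eps / 12.
have s0 : 0 < s by rewrite divr_gt0.
have eta0 : 0 < eta by rewrite divr_gt0.
have [m Hm] := Lo_ge s0 eta0.
(* The three entries ensure, in turn, that [N >= m], that [s * h] exceeds [- ln eta], and that
   [eps * (h / r)] is at least 2, which absorbs the rounding of [z] down to [N]. *)
pose H0 := Num.max (m%:R * r / (1 - 2 * s)) (Num.max (- ln eta / s) (2 * r / eps)).
have eta1 : eta < 1 by rewrite /eta; lra.
exists (Num.min eta (expR (- H0))); split.
  by rewrite lt_min eta0 expR_gt0/= gt_min eta1.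
move=> x y /andP[x0]; rewrite lt_min => /andP[xeta xH] /andP[y0].
rewrite lt_min => /andP[yeta yH].
have x1 : x < 1 by exact: lt_trans xeta eta1.
have y1 : y < 1 by exact: lt_trans yeta eta1.
have [|h1 lnx xE] := @ln_near0 R H0 x _ x1; first by rewrite x0.
set h := `|ln x| in h1 lnx xE *.
move: h1; rewrite /H0 !gt_max => /and3P[hm heta hr].
have s2 : 0 < 1 - 2 * s by rewrite /s; lra.
pose z := (1 - 2 * s) * (h / r).
have hr0 : 0 < h / r.
  by rewrite divr_gt0//; apply: lt_trans hr; rewrite divr_gt0// mulr_gt0.
have z0 : 0 <= z by rewrite /z mulr_ge0// ltW.
pose N := Num.truncn z.
have /andP[Nz zN] : N%:R <= z < N.+1%:R by exact: truncn_itv.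
have mN : (m <= N)%N.
  rewrite /N truncn_ge_nat// /z mulrA ler_pdivlMr//.
  by move: hm; rewrite ltr_pdivrMr// [leRHS]mulrC => /ltW.
apply: le_trans (Hm N mN x y _ _); rewrite ?x0 ?y0//.
rewrite lee_fin.
have small : expR (r * (1 + s) * N%:R) * x <= eta.
  rewrite [X in _ * X]xE -expRD -[leRHS]lnK ?posrE// ler_expR.
  have H1 : r * N%:R <= (1 - 2 * s) * h.
    by rewrite mulrC -ler_pdivlMr// -mulrA.
  have H2 : (r * N%:R) * (1 + s) <= (1 - 2 * s) * h * (1 + s) by rewrite ler_pM2r//; lra.
  have H3 : - ln eta <= s * h.
    by rewrite mulrC -ler_pdivrMr// ltW.
  have h0 : 0 <= h by rewrite normr_ge0.
  have H4 : 0 <= s * s * h by rewrite !mulr_ge0// ltW.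
  have -> : r * (1 + s) * N%:R = r * N%:R * (1 + s) by ring.
  nra.
have key : 2 <= eps * (h / r).
  by move: hr; rewrite ltr_pdivrMr// mulrA ler_pdivlMr// [leRHS]mulrC => /ltW.
set w := h / r in z hr0 z0 N Nz zN mN small key *.
have N1 : (1 - eps / 4) * w - 1 <= N%:R.
  have -> : eps / 4 = 2 * s by rewrite /s; field.
  by rewrite lerBlDr natr1 ltW.
have N0 : 0 <= (N%:R : R) by [].
(* [y], [eta] and the exponential term are each at most [eta]. *)
apply: (@le_trans _ _ (N%:R * (1 - 3 * eta))).
  have -> : 3 * eta = eps / 4 by rewrite /eta; field.
  have : ((1 - eps / 4) * w - 1) * (1 - eps / 4) <= N%:R * (1 - eps / 4).
    by rewrite ler_pM2r//; lra.
  have : 0 <= eps * eps * w by apply: mulr_ge0 (ltW hr0); exact: mulr_ge0 (ltW eps0) (ltW eps0).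
  nra.
by rewrite ler_wpM2l//; lra.
Qed.

Let asymptotic_lower (eps : R) : 0 < eps -> exists delta, 0 < delta < 1 /\
  forall x y, 0 < x < delta -> 0 < y < delta ->
    (((1 - eps) * (`|ln x| / r))%:E <= Lo x y)%E.
Proof.
move=> eps0; have e0 : 0 < Num.min eps 2^-1 <= 2^-1.
  by rewrite lt_min eps0 invr_gt0 ltr0n/= ge_min lexx orbT.
have [delta [d01 H]] := asymptotic_lower_small e0.
exists delta; split=> // x y xd yd; apply: le_trans (H x y xd yd).
rewrite lee_fin ler_wpM2r//; first by rewrite divr_ge0// ltW.
by rewrite lerD2l lerN2 ge_min lexx.
Qed.

Let asymptotic_upper (eps : R) : 0 < eps -> exists delta, 0 < delta < 1 /\
  forall x y, 0 < x < delta -> 0 < y < delta ->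
    (Hi x y <= ((1 + eps) * (`|ln x| / r))%:E)%E.
Proof.
move=> eps0.
(* This solves [(1 + s) / (1 - s) = 1 + eps / 2]. *)
pose s := eps / (4 + eps).
have s0 : 0 < s by rewrite divr_gt0// addr_gt0.
have s1 : s < 1 by rewrite ltr_pdivrMr ?mul1r ?ltrDr// addr_gt0.
have sE : s * (4 + eps) = eps by rewrite /s mulfVK// gt_eqF// addr_gt0.
have s01 : 0 < s < 1 by rewrite s0 s1.
have [C HC] := Hi_le s01.
have [delta [delta0 Hthr]] := thr_sim s0.
(* Of [2 + C], one unit pays for rounding [z] up to [N], one for the successor in [N.+1], and [C]
   comes from [Hi_le]; half of [eps] absorbs them all. *)
pose H0 := Num.max 0 ((2 + C) * r / (eps / 2)).
exists (Num.min (Num.min delta 2^-1) (expR (- H0))); split.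
  rewrite !lt_min delta0 expR_gt0 invr_gt0 ltr0n/= !gt_min.
  by rewrite (_ : 2^-1 < 1) ?orbT//; lra.
move=> x y /andP[x0]; rewrite !lt_min => /andP[/andP[xd x2] xH].
move=> /andP[y0] /andP[/andP[yd y2] _].
have x1 : x < 1 by apply: lt_trans x2 _; lra.
have y1 : y < 1 by apply: lt_trans y2 _; lra.
have [|h1 lnx xE] := @ln_near0 R H0 x _ x1; first by rewrite x0.
have := Hthr x y; rewrite x0 xd y0 yd => /(_ isT isT).
rewrite !lee_fin => /andP[thrl thru].
set h := `|ln x| in h1 lnx xE thrl thru *.
move: h1; rewrite /H0 gt_max => /andP[h0 hC].
have r1s : 0 < r * (1 - s) by rewrite mulr_gt0// subr_gt0.
have thr0 : 0 <= thr x y.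
  by apply: le_trans thrl; rewrite mulr_ge0// ?ltW// subr_gt0.
pose z := thr x y / (r * (1 - s)).
have z0 : 0 <= z by rewrite /z divr_ge0// ltW.
pose N := (Num.truncn z).+1.
have /andP[Nz zN] : (Num.truncn z)%:R <= z < N%:R by exact: truncn_itv.
have x01 : 0 < x < 1 by rewrite x0.
have y01 : 0 < y < 1 by rewrite y0.
apply: (le_trans (HC N x y x01 y01 _)).
  by rewrite mulrC -ler_pdivrMr// ltW.
rewrite lee_fin -natr1.
set w := h / r.
have w0 : 0 < w by rewrite divr_gt0.
have zw : z <= (1 + eps / 2) * w.
  rewrite /z ler_pdivrMr//; apply: (le_trans thru).
  have -> : (1 + eps / 2) * w * (r * (1 - s)) = (1 + eps / 2) * (1 - s) * h.
    by rewrite /w; field; rewrite gt_eqF.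
  by rewrite ler_pM2r//; nra.
have Cw : 2 + C <= eps / 2 * w.
  move: hC; rewrite ltr_pdivrMr ?divr_gt0// => hC.
  by rewrite /w mulrA ler_pdivlMr// [leRHS]mulrC ltW.
have : (N%:R : R) <= z + 1 by rewrite /N -natr1 lerD2r.
move: zw Cw; lra.
Qed.

(** The lower bound is proved for [Lo] and the upper bound for [Hi]; [LoHi] transfers each to the
    other function. *)
Lemma sim0_of_bounds :
  sim0 Hi (fun x y => `|ln x| / r) /\ sim0 Lo (fun x y => `|ln x| / r).
Proof.
suff both eps : 0 < eps -> exists delta, 0 < delta /\
    forall x y, 0 < x < delta -> 0 < y < delta ->
      [/\ (((1 - eps) * (`|ln x| / r))%:E <= Lo x y)%E, (Lo x y <= Hi x y)%E &
          (Hi x y <= ((1 + eps) * (`|ln x| / r))%:E)%E].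
  split=> eps /both[delta [delta0 H]]; exists delta; split=> // x y x0 y0;
    have [H1 H2 H3] := H x y x0 y0; apply/andP; split=> //.
    exact: le_trans H2.
  exact: le_trans H3.
move=> eps0.
have [d1 [/andP[d10 d11] H1]] := asymptotic_lower eps0.
have [d2 [/andP[d20 d21] H2]] := asymptotic_upper eps0.
exists (Num.min d1 d2); split; first by rewrite lt_min d10.
move=> x y; rewrite !lt_min => /andP[x0 /andP[x1 x2]] /andP[y0 /andP[y1 y2]].
split; [by apply: H1; rewrite ?x0 ?y0| |by apply: H2; rewrite ?x0 ?y0].
by apply: LoHi; rewrite ?x0 ?y0/=; [exact: lt_trans d11|exact: lt_trans d11].
Qed.
End asymptotics.

(** * Independent streams *)

Section model.
Context {d : measure_display} {Omega : measurableType d} {R : realType} {K : nat}.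
Context {dS : 'I_K -> measure_display} {S : forall k, measurableType (dS k)}.
Variable X : forall k : 'I_K, nat -> Omega -> S k.
Variable P : {set 'I_K} -> probability Omega R.
Variable lam : 'I_K -> nat -> Omega -> R.
Hypothesis mX : forall k t, measurable_fun setT (X k t).
Hypothesis P_indep : forall (A : {set 'I_K}) (E : 'I_K -> set Omega),
  (forall k, Fk_inf X k (E k)) ->
  P A (\bigcap_k E k) = (\prod_(k : 'I_K) P A (E k))%E.
Hypothesis P_marginal : forall (A : {set 'I_K}) (k : 'I_K) (E : set Omega),
  Fk_inf X k E -> P A E = if k \in A then P (sing k) E else P emptyK E.
Hypothesis lam_llr : forall (k : 'I_K) (n : nat), (0 < n)%N ->
  (forall B : set R, measurable B -> Fk X k n (lam k n @^-1` B)) /\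
  (forall E, Fk X k n E ->
     P (sing k) E = (\int[P emptyK]_(w in E) (expR (lam k n w))%:E)%E).

(** * Change of measure between signal sets *)

Lemma lam_Fk k n B : (0 < n)%N -> measurable B -> Fk X k n (lam k n @^-1` B).
Proof. by move=> n0; case: (lam_llr k n0) => + _; apply. Qed.

Lemma lam_measurable k n : (0 < n)%N -> measurable_fun setT (lam k n).
Proof.
move=> n0 _ B mB; rewrite setTI.
by apply: (Fk_measurable mX); exact: lam_Fk.
Qed.

(* A rectangle factors into its [i]-th side, which carries the density, and the
   other sides, on which [P B] and [P (i |: B)] coincide. *)
Lemma change_of_measure_rectangle (B : {set 'I_K}) (i : 'I_K) n E :
    (0 < n)%N -> i \notin B -> rectangles X n E ->
  P (i |: B)%SET E = exp_density (P B) (lam i n) E.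
Proof.
move=> n0 iB [F [mF ->]].
have mFi k : Fk_inf X k (F k) by exact: Fk_Fk_inf (mF k).
have mF' k : measurable (F k) by exact: (Fk_inf_measurable mX (mFi k)).
have mcap : measurable (\bigcap_k F k).
  by apply: (Fn_measurable mX (n := n)); apply: rectangles_Fn; exists F.
have fin k : P B (F k) \is a fin_num by exact: fin_num_measure.
pose p : R := \prod_(k | k != i) fine (P B (F k)).
have p0 : 0 <= p by apply: prodr_ge0 => k _; rewrite fine_ge0.
have pE : (p%:E = \prod_(k | k != i) P B (F k))%E.
  by rewrite /p -prodEFin; apply: eq_bigr => k _; rewrite fineK.
have capE A G : Fk_inf X i G -> A = B \/ A = (i |: B)%SET ->
    P A (\bigcap_k (if k == i then F k `&` G else F k)) = (P A (F i `&` G) * p%:E)%E.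
  move=> mG AB; rewrite P_indep => [|k]; last first.
    by case: eqP => [->|_] //; exact: Fk_infI.
  rewrite (bigD1 i)//= eqxx pE; congr (_ * _)%E.
  apply: eq_bigr => k ki; rewrite (negbTE ki).
  case: AB => -> //.
  by rewrite (P_marginal (i |: B)%SET (mFi k)) [RHS](P_marginal B (mFi k)) in_setU1 (negbTE ki).
have capT : \bigcap_k F k = \bigcap_k (if k == i then F k `&` setT else F k).
  by apply: eq_bigcap => // k _; rewrite setIT if_same.
have capG G : \bigcap_k F k `&` G = \bigcap_k (if k == i then F k `&` G else F k).
  apply/seteqP; split => [w [Fw Gw] k _|w Fw]; first by case: ifP => _; [split=> //|]; exact: Fw.
  split=> [k _|]; last by have := Fw i I; rewrite eqxx => -[].
  by have := Fw k I; case: ifP => // _ [].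
rewrite [in LHS]capT capE; [|exact: Fk_infT|by right].
rewrite setIT (P_marginal _ (mFi i)) setU11.
have [_ ->] := lam_llr i n0; last exact: mF.
rewrite /exp_density.
pose q : {nonneg R} := NngNum p0.
have mlam := lam_measurable i n0.
rewrite muleC.
(* The constant [p] and the side [F i] are moved into the measure, so that both integrals are of the
   same function over the whole space and only preimages under [lam i n] have to be compared. *)
transitivity (\int[mscale q (mrestr (P emptyK) (mF' i))]_w (expR (lam i n w))%:E)%E.
  rewrite ge0_integral_mscale//; last exact/measurable_EFinP/measurableT_comp.
  by rewrite -integral_expR_mrestr.
rewrite (integral_expR_mrestr _ mcap)//.
apply: eq_integral_expR => // C mC.
have mG : Fk_inf X i (lam i n @^-1` C) by exact: Fk_Fk_inf (lam_Fk n0 mC).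
rewrite /mscale /= /mrestr /= [X in P B X]setIC capG (capE B)//; last by left.
rewrite (P_marginal B (Fk_infI (mFi i) mG)) (negbTE iB).
by rewrite muleC; congr (_ * P _ _)%E; rewrite setIC.
Qed.

(** Both sides are measures in [E] that agree on the rectangles, a pi-system containing the whole
    space; being finite, they agree on the generated sigma-algebra, which contains [Fn X n]. *)
Lemma change_of_measure (B : {set 'I_K}) (i : 'I_K) n E :
    (0 < n)%N -> i \notin B -> Fn X n E ->
  P (i |: B)%SET E = (\int[P B]_(w in E) (expR (lam i n w))%:E)%E.
Proof.
move=> n0 iB /Fn_rectangles EG.
have mlam := lam_measurable i n0.
rewrite -[RHS]/(exp_density (P B) (lam i n) E).
have eqG A : rectangles X n A -> P (i |: B)%SET A = exp_density (P B) (lam i n) A.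
  exact: change_of_measure_rectangle.
have subm : rectangles X n `<=` measurable.
  exact: subset_trans (@rectangles_Fn _ _ _ _ _ X n) (Fn_measurable mX (n := n)).
apply: (g_sigma_algebra_measure_unique (rectangles X n) subm (fun=> setT) _ _
   (P (i |: B)%SET) (exp_density (P B) (lam i n))) => //.
- by move=> _; exact: rectanglesT.
- by rewrite bigcup_const//; exists 0%N.
- exact: rectangles_setI.
- by move=> _ /=; rewrite probability_setT ltry.
Qed.

Lemma change_of_measure_remove (B : {set 'I_K}) i n x E :
    (0 < n)%N -> i \notin B -> Fn X n E ->
  (P (i |: B)%SET (E `&` [set w | (lam i n w <= x)%R]) <= (expR x)%:E * P B E)%E.
Proof.
move=> n0 iB GE; have mE := Fn_measurable mX GE.
have GC : Fn X n [set w | lam i n w <= x].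
  rewrite (_ : [set w | _] = lam i n @^-1` `]-oo, x]).
    by apply: (@Fk_Fn _ _ _ _ _ _ i); exact: lam_Fk.
  by apply/seteqP; split=> w /=; rewrite in_itv.
have mC := Fn_measurable mX (FnI GE GC).
rewrite (change_of_measure n0 iB (FnI GE GC)).
apply: (@le_trans _ _ ((expR x)%:E *
    exp_density (P B) (fun=> 0%R) (E `&` [set w | (lam i n w <= x)%R]))%E).
  apply: le_exp_density => //; first exact: lam_measurable.
  by move=> w [_ /=]; rewrite addr0.
rewrite exp_density_0//; apply: lee_wpmul2l; first by rewrite lee_fin expR_ge0.
by apply: le_measure; rewrite ?inE//; exact: subIsetl.
Qed.

(** Here [P B] is the law to be bounded: on the event, the density of [P (j |: B)] against it is at
    least [expR (- x)]. *)
Lemma change_of_measure_add (B : {set 'I_K}) j n x E :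
    (0 < n)%N -> j \notin B -> Fn X n E ->
  (P B (E `&` [set w | (- lam j n w <= x)%R]) <= (expR x)%:E * P (j |: B)%SET E)%E.
Proof.
move=> n0 jB GE; have mE := Fn_measurable mX GE.
have GC : Fn X n [set w | - lam j n w <= x].
  rewrite (_ : [set w | _] = lam j n @^-1` `[- x, +oo[).
    by apply: (@Fk_Fn _ _ _ _ _ _ j); exact: lam_Fk.
  by apply/seteqP; split=> w /=; rewrite in_itv /= andbT lerNl.
have mC := Fn_measurable mX (FnI GE GC).
rewrite -exp_density_0//.
apply: (@le_trans _ _ ((expR x)%:E * P (j |: B)%SET (E `&` [set w | (- lam j n w <= x)%R]))%E).
  rewrite (change_of_measure n0 jB (FnI GE GC)).
  apply: le_exp_density => //; first exact: lam_measurable.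
  by move=> w [_ /=]; rewrite lerNl -subr_ge0 opprK addrC.
apply: lee_wpmul2l; first by rewrite lee_fin expR_ge0.
by apply: le_measure; rewrite ?inE//; exact: subIsetl.
Qed.

(** Both laws have densities against the common reference [P B], with quotient
    [expR (lam i n - lam j n)]. *)
Lemma change_of_measure_swap (B : {set 'I_K}) i j n x E :
    (0 < n)%N -> i \notin B -> j \notin B -> Fn X n E ->
  (P (i |: B)%SET (E `&` [set w | (lam i n w - lam j n w <= x)%R]) <=
   (expR x)%:E * P (j |: B)%SET E)%E.
Proof.
move=> n0 iB jB GE; have mE := Fn_measurable mX GE.
have GC : Fn X n [set w | lam i n w - lam j n w <= x].
  have mfn k : measurable_fun [set: g_sigma_algebraType (\bigcup_k gen_stream X k n)] (lam k n).
    by move=> _ C mC; rewrite setTI; apply: (@Fk_Fn _ _ _ _ _ _ k); exact: lam_Fk.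
  have := measurable_funB (mfn i) (mfn j).
  move=> /(_ measurableT `]-oo, x]%classic); rewrite setTI => H.
  rewrite (_ : [set w | _] = (lam i n \- lam j n) @^-1` `]-oo, x]); first exact: H.
  by apply/seteqP; split=> w /=; rewrite in_itv.
have mC := Fn_measurable mX (FnI GE GC).
apply: (@le_trans _ _ ((expR x)%:E *
    P (j |: B)%SET (E `&` [set w | (lam i n w - lam j n w <= x)%R]))%E).
  rewrite (change_of_measure n0 iB (FnI GE GC)) (change_of_measure n0 jB (FnI GE GC)).
  apply: le_exp_density => //; [exact: lam_measurable|exact: lam_measurable|].
  by move=> w [_ /=]; rewrite lerBlDr.
apply: lee_wpmul2l; first by rewrite lee_fin expR_ge0.
by apply: le_measure; rewrite ?inE//; exact: subIsetl.
Qed.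

(** * Linear growth of the log-likelihood ratios *)

Variables I J : 'I_K -> R.
Hypothesis I_gt0 : forall k, 0 < I k.
Hypothesis J_gt0 : forall k, 0 < J k.
Hypothesis lam_limsup1 : forall k,
  P (sing k) [set w | (limn_esup (fun n => (lam k n.+1 w / n.+1%:R)%:E) <= (I k)%:E)%E] = 1%E.
Hypothesis lam_limsup0 : forall k,
  P emptyK [set w | (limn_esup (fun n => (- lam k n.+1 w / n.+1%:R)%:E) <= (J k)%:E)%E] = 1%E.
Hypothesis lam_complete1 : forall k (eps : R), 0 < eps ->
  (\sum_(0 <= n <oo) P (sing k) [set w | (lam k n.+1 w / n.+1%:R <= I k - eps)%R] < +oo)%E.
Hypothesis lam_complete0 : forall k (eps : R), 0 < eps ->
  (\sum_(0 <= n <oo) P emptyK [set w | (- lam k n.+1 w / n.+1%:R <= J k - eps)%R] < +oo)%E.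

(* Under [P A] every stream is described by the log-likelihood ratio of its true
   hypothesis against the false one, which grows at rate [rate A k]. *)
Definition true_llr (A : {set 'I_K}) k n w : R := if k \in A then lam k n w else - lam k n w.
Definition rate (A : {set 'I_K}) k : R := if k \in A then I k else J k.

Lemma rate_gt0 A k : 0 < rate A k.
Proof. by rewrite /rate; case: ifP. Qed.

Lemma true_llr_Fk A k n B : (0 < n)%N -> measurable B -> Fk X k n (true_llr A k n @^-1` B).
Proof.
move=> n0 mB; rewrite /true_llr; case: (k \in A); first exact: lam_Fk.
apply: (@lam_Fk k n ((fun x : R => - x) @^-1` B)) => //.
by rewrite -[X in measurable X]setTI; exact: (measurable_funN (@measurable_id _ _ setT)).
Qed.

Lemma true_llr_measurable A k n : (0 < n)%N -> measurable_fun setT (true_llr A k n).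
Proof. by move=> n0 _ B mB; rewrite setTI; apply: (Fk_measurable mX); exact: true_llr_Fk. Qed.

(** The overshoot event belongs to stream [k] alone, so [P A] may be replaced by the law of [sing k]
    or [emptyK], for which the limsup hypotheses are stated. *)
Lemma true_llr_overshoot A (eta : R) k s : 0 < s -> 0 < eta ->
  exists m, (P A (overshoot (true_llr A k) (rate A k * (1 + s)) m) <= eta%:E)%E.
Proof.
move=> s0 eta0.
have mO m : Fk_inf X k (overshoot (true_llr A k) (rate A k * (1 + s)) m).
  rewrite overshoot_bigcup; apply: (@bigcupT_measurable _ (g_sigma_algebraType _)) => n.
  by apply: (@Fk_Fk_inf _ _ _ _ _ _ k n.+1); exact: true_llr_Fk.
have r_lt : rate A k < rate A k * (1 + s) by rewrite ltr_pMr ?rate_gt0// ltrDl.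
pose B : {set 'I_K} := if k \in A then sing k else emptyK.
have [m Bm] : exists m, (P B (overshoot (true_llr A k) (rate A k * (1 + s)) m) <= eta%:E)%E.
  apply: overshoot_vanish (rate_gt0 A k) r_lt eta0.
    by move=> n n0; exact: true_llr_measurable.
  by rewrite /B /rate /true_llr; case: (k \in A); [exact: lam_limsup1|exact: lam_limsup0].
exists m; rewrite (P_marginal A (mO m)); move: Bm; rewrite /B.
by case: ifP.
Qed.

Lemma true_llr_upper A (s eta : R) : 0 < s -> 0 < eta ->
  exists m (Bad : set Omega), [/\ measurable Bad, (P A Bad <= eta%:E)%E &
    forall w, ~ Bad w -> forall k n, (0 < n)%N ->
      true_llr A k n w <= rate A k * (1 + s) * (maxn n m)%:R].
Proof.
move=> s0 eta0.
(* Equal shares for a union bound over the [K] streams, with a denominator that is always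
   positive. *)
have e0 : 0 < eta / K.+1%:R by rewrite divr_gt0.
have /choice[m Hm] := fun k => @true_llr_overshoot A _ k s s0 e0.
have mO k : measurable (overshoot (true_llr A k) (rate A k * (1 + s)) (m k)).
  rewrite overshoot_bigcup; apply: bigcupT_measurable => n.
  by rewrite -[X in measurable X]setTI; exact: true_llr_measurable.
exists (\max_k m k)%N,
  (\big[setU/set0]_(k < K) overshoot (true_llr A k) (rate A k * (1 + s)) (m k)).
split; first exact: bigsetU_measurable.
- apply: (le_trans (measure_bigsetU_le (P A) mO)).
  apply: (@le_trans _ _ (\sum_(k < K) (eta / K.+1%:R)%:E)%E).
    by apply: lee_sum => k _; exact: Hm.
  rewrite sumEFin lee_fin sumr_const card_ord -mulrnAr -[leRHS]mulr1 ler_pM2l//.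
  by rewrite -mulr_natr mulrC ler_pdivrMr// mul1r ler_nat.
- move=> w nO k n n0; rewrite leNgt; apply/negP => Yn; apply: nO.
  rewrite -bigcup_seq; exists k; first by rewrite /= mem_index_enum.
  exists n; split=> //; apply: le_lt_trans Yn.
  rewrite ler_pM2l; last by rewrite mulr_gt0 ?rate_gt0// addr_gt0.
  rewrite ler_nat geq_max leq_maxl/= leq_max.
  by rewrite (leq_bigmax k) orbT.
Qed.

(** Complete convergence with tolerance [rate A k * s]; the union over finitely many streams
    preserves summability. The event [B n] concerns time [n.+1]. *)
Lemma true_llr_lower A (s : R) : 0 < s ->
  exists B : nat -> set Omega, [/\ forall n, measurable (B n),
    (\sum_(0 <= n <oo) P A (B n) < +oo)%E &
    forall w n, ~ B n w -> forall k, rate A k * (1 - s) * n.+1%:R < true_llr A k n.+1 w].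
Proof.
move=> s0.
pose F k n := [set w | true_llr A k n.+1 w / n.+1%:R <= rate A k - rate A k * s].
have FE k n : F k n = true_llr A k n.+1 @^-1` `]-oo, (rate A k - rate A k * s) * n.+1%:R].
  by apply/seteqP; split=> w; rewrite /F /= in_itv/= ler_pdivrMr.
have mFk k n : Fk_inf X k (F k n).
  by rewrite FE; apply: (@Fk_Fk_inf _ _ _ _ _ _ k n.+1); exact: true_llr_Fk.
have mF k n : measurable (F k n) by exact: (Fk_inf_measurable mX (mFk k n)).
exists (fun n => \big[setU/set0]_(k < K) F k n); split.
- by move=> n; exact: bigsetU_measurable.
- apply: (@le_lt_trans _ _ (\sum_(0 <= n <oo) \sum_(k < K) P A (F k n))%E).
    by apply: lee_nneseries => // n _; exact: measure_bigsetU_le.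
  rewrite nneseries_sum//; apply: lte_sum_pinfty => k _.
  under eq_eseriesr do rewrite (P_marginal A (mFk k _)).
  rewrite /F /rate /true_llr; case: (k \in A).
    by apply: lam_complete1; rewrite mulr_gt0.
  by apply: lam_complete0; rewrite mulr_gt0.
- move=> w n nB k; rewrite ltNge; apply/negP => Hle; apply: nB.
  rewrite -bigcup_seq; exists k; first by rewrite /= mem_index_enum.
  by rewrite /F /= ler_pdivrMr// -[X in X - _]mulr1 -mulrBr.
Qed.

(** * Lower bound for all admissible procedures *)

Section procedures.
Variables (l u : nat).
Hypothesis lK : (l < K)%N.
Hypothesis u_gt0 : (0 < u)%N.

(** [fine] meets a finite value: [#|A| = l < K] leaves a stream outside [A], and in [rate_out] the
    equality [#|A| = u > 0] gives one inside. *)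
Definition rate_in (A : {set 'I_K}) i : R :=
  I i + (if #|A| == l then fine (calJ J A) else 0).
Definition rate_out (A : {set 'I_K}) j : R :=
  J j + (if #|A| == u then fine (calI I A) else 0).

(** The minimiser [j] is exhibited because the lower bound exchanges [i] with it; its minimality
    serves the upper bound. *)
Lemma rate_inP (A : {set 'I_K}) i : (#|A| <> l /\ rate_in A i = I i) \/
  exists j, [/\ #|A| = l, j \notin A, rate_in A i = I i + J j & forall k, k \notin A -> J j <= J k].
Proof.
rewrite /rate_in; case: eqP => Al; last by left; rewrite addr0.
have /set0Pn[j0] : ~: A != finset.set0.
  by rewrite -card_gt0 cardsCs finset.setCK card_ord Al subn_gt0.
rewrite inE => j0A.
have [j [jA jE jmin]] := @ereal_inf_min _ _ J (fun j => j \notin A) j0 j0A.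
by right; exists j; split=> //; rewrite /calJ jE.
Qed.

Lemma rate_outP (A : {set 'I_K}) j : (#|A| <> u /\ rate_out A j = J j) \/
  exists i, [/\ #|A| = u, i \in A, rate_out A j = J j + I i & forall k, k \in A -> I i <= I k].
Proof.
rewrite /rate_out; case: eqP => Au; last by left; rewrite addr0.
have /set0Pn[i0 i0A] : A != finset.set0 by rewrite -card_gt0 Au.
have [i [iA iE imin]] := @ereal_inf_min _ _ I (fun i => i \in A) i0 i0A.
by right; exists i; split=> //; rewrite /calI iE.
Qed.

Section one_procedure.
Variables (alpha beta : R) (T : 'I_K -> Omega -> option nat) (D : 'I_K -> Omega -> bool).
Hypothesis TD : Delta X P alpha beta (Pi_lu l u) (T, D).

Let mD k : measurable [set w | D k w].
Proof. by have [/(_ k)[_ _ + _] _] := TD; exact: F_inf_measurable. Qed.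

Definition error_bound (A : {set 'I_K}) k : R := if k \in A then beta else alpha.

Lemma wrong_decision_le A k : Pi_lu l u A ->
  (P A [set w | D k w == (k \notin A)] <= (error_bound A k)%:E)%E.
Proof.
move=> PiA; have [_ /(_ A PiA)[F1 F2]] := TD; rewrite /error_bound.
case: ifP => kA.
  apply: le_trans F2; apply: le_trans (FWE2_ge P mD kA).
  rewrite (_ : [set w | _] = ~` [set w | D k w])//.
  by apply/seteqP; split=> w /=; case: (D k w).
apply: le_trans F1; apply: le_trans (FWE1_ge P mD (negbT kA)).
rewrite (_ : [set w | _] = [set w | D k w])//.
by apply/seteqP; split=> w /=; case: (D k w).
Qed.

(* [A] and [A'] disagree about stream [k], so the decision that is right under [P A] is
   wrong under [P A']. *)
Lemma procedure_time_lower A A' k (L : nat -> Omega -> R) (x eta : R) N (Bad : set Omega) :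
    Pi_lu l u A -> Pi_lu l u A' -> (k \in A') = (k \notin A) ->
    (forall n, (0 < n)%N -> measurable_fun setT (L n)) ->
    (forall n y E, (0 < n)%N -> Fn X n E ->
      (P A (E `&` [set w | (L n w <= y)%R]) <= (expR y)%:E * P A' E)%E) ->
    measurable Bad -> (P A Bad <= eta%:E)%E ->
    (forall w n, ~ Bad w -> (0 < n <= N)%N -> L n w <= x) ->
  ((N%:R * (1 - (error_bound A k + eta + expR x * error_bound A' k)))%:E <= ET P A (T k))%E.
Proof.
move=> PiA PiA' kAA' mL QQ' mBad PBad LBad.
have [/(_ k)[[T0 GT] _ _ GTD] _] := TD.
pose b := k \in A.
have bE : [set w | D k w == b] = if b then [set w | D k w] else ~` [set w | D k w].
  by apply/seteqP; split=> w; case: b => /=; case: (D k w).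
have GTDb n : Fn X n [set w | T k w = Some n /\ D k w == b].
  case: b {bE}; first by under eq_set do rewrite eqb_id; exact: GTD.
  rewrite (_ : [set w | _] = [set w | T k w = Some n] `\` [set w | T k w = Some n /\ D k w]).
    by apply: FnD; [exact: GT|exact: GTD].
  apply/seteqP; split=> w /=; first by move=> [-> /eqP ->]; split=> // -[].
  by move=> [Tw nD]; split=> //; rewrite eqbF_neg; apply/negP => Dw; apply: nD.
have mDb : measurable [set w | D k w == b].
  by rewrite bE; case: b {bE GTDb} => //; exact: measurableC.
apply: (@expected_time_lower _ _ _ (P A) (P A') (Fn X) L (T k) (fun w => D k w == b)
   _ T0 GT GTDb mDb mL QQ' N x Bad eta) => //.
- by move=> n; exact: Fn_measurable.
- rewrite (_ : ~` _ = [set w | D k w == (k \notin A)]); first exact: wrong_decision_le.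
  by apply/seteqP; split=> w /=; rewrite /b; case: (D k w); case: (k \in A).
- rewrite (_ : [set w | _] = [set w | D k w == (k \notin A')]); first exact: wrong_decision_le.
  by apply/seteqP; split=> w /=; rewrite /b kAA' negbK.
Qed.
End one_procedure.

Let bound_scale (r s y : R) (m N n : nat) :
  (m <= N)%N -> (0 < n <= N)%N -> 0 < r -> 0 < s ->
  y <= r * (1 + s) * (maxn n m)%:R -> y <= r * (1 + s) * N%:R.
Proof.
move=> mN /andP[_ nN] r0 s0 /le_trans; apply.
by rewrite ler_pM2l ?ler_nat ?geq_max ?nN// mulr_gt0// addr_gt0.
Qed.

(** [m] is chosen before [N], the error levels and the procedure; this uniformity lets the bound
    pass to the infimum [Lopt] and then to the limit. *)
Lemma time_lower_in A i (s eta : R) : Pi_lu l u A -> i \in A -> 0 < s -> 0 < eta ->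
  exists m, forall N, (m <= N)%N -> forall alpha beta chi,
    Delta X P alpha beta (Pi_lu l u) chi ->
    ((N%:R * (1 - (beta + eta + expR (rate_in A i * (1 + s) * N%:R) * alpha)))%:E
      <= ET P A (chi.1 i))%E.
Proof.
move=> PiA iA s0 eta0.
have [m [Bad [mBad PBad HBad]]] := true_llr_upper A s0 eta0.
exists m => N mN alpha beta [T D] TD /=.
pose B := (A :\ i)%SET.
have iB : i \notin B by rewrite !inE eqxx.
have AE : A = (i |: B)%SET by rewrite finset.setD1K.
have cardA : #|A| = #|B|.+1 by rewrite AE cardsU1 iB.
have PB : #|A| <> l -> Pi_lu l u B.
  move=> Al; move: PiA; rewrite /Pi_lu; case/andP => lA Au.
  apply/andP; split; last by rewrite (leq_trans _ Au)// cardA.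
  by rewrite -ltnS -cardA ltn_neqAle lA andbT eq_sym; apply/eqP.
have LBi w n : ~ Bad w -> (0 < n <= N)%N -> lam i n w <= I i * (1 + s) * N%:R.
  move=> nB nN; have := HBad w nB i n; rewrite /true_llr /rate iA => H.
  by apply: bound_scale (H _) => //; case/andP: nN.
have -> : beta = error_bound alpha beta A i by rewrite /error_bound iA.
case: (rate_inP A i) => [[Al ->]|[j [Al jA -> _]]].
  have -> : (expR (I i * (1 + s) * N%:R) * alpha =
     expR (I i * (1 + s) * N%:R) * error_bound alpha beta B i)%R.
    by rewrite /error_bound (negbTE iB).
  apply: (procedure_time_lower TD (L := lam i) (Bad := Bad)) => //.
  - exact: PB.
  - by rewrite iA (negbTE iB).
  - by move=> n n0; exact: lam_measurable.
  - by move=> n y E n0 GE; rewrite [in X in (X <= _)%E]AE; exact: change_of_measure_remove.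
have ji : j != i by apply: contraNneq jA => ->.
have jB : j \notin B by rewrite !inE negb_and jA orbT.
have iB' : i \notin (j |: B)%SET by rewrite in_setU1 negb_or eq_sym ji.
have -> : (expR ((I i + J j) * (1 + s) * N%:R) * alpha =
     expR ((I i + J j) * (1 + s) * N%:R) * error_bound alpha beta (j |: B)%SET i)%R.
  by rewrite /error_bound (negbTE iB').
apply: (procedure_time_lower TD (L := fun n w => lam i n w - lam j n w) (Bad := Bad)) => //.
- by move: PiA; rewrite /Pi_lu cardsU1 jB cardA.
- by rewrite iA (negbTE iB').
- by move=> n n0; apply: measurable_funB; exact: lam_measurable.
- by move=> n y E n0 GE; rewrite [in X in (X <= _)%E]AE; exact: change_of_measure_swap.
- move=> w n nB nN; have Hi := LBi w n nB nN.
  have := HBad w nB j n; rewrite /true_llr /rate (negbTE jA) => H.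
  have Hj : - lam j n w <= J j * (1 + s) * N%:R.
    by apply: bound_scale (H _) => //; case/andP: nN.
  by rewrite !mulrDl lerD.
Qed.

(** The alternative adds [j] to [A] if [#|A| < u], and otherwise puts [j] in place of the [i \in A]
    with the smallest [I i]. The ratio in favour of [P A] is [- lam j], respectively
    [lam i - lam j]. *)
Lemma time_lower_out A j (s eta : R) : Pi_lu l u A -> j \notin A -> 0 < s -> 0 < eta ->
  exists m, forall N, (m <= N)%N -> forall alpha beta chi,
    Delta X P alpha beta (Pi_lu l u) chi ->
    ((N%:R * (1 - (alpha + eta + expR (rate_out A j * (1 + s) * N%:R) * beta)))%:E
      <= ET P A (chi.1 j))%E.
Proof.
move=> PiA jA s0 eta0.
have [m [Bad [mBad PBad HBad]]] := true_llr_upper A s0 eta0.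
exists m => N mN alpha beta [T D] TD /=.
have LBj w n : ~ Bad w -> (0 < n <= N)%N -> - lam j n w <= J j * (1 + s) * N%:R.
  move=> nB nN; have := HBad w nB j n; rewrite /true_llr /rate (negbTE jA) => H.
  by apply: bound_scale (H _) => //; case/andP: nN.
have -> : alpha = error_bound alpha beta A j by rewrite /error_bound (negbTE jA).
case: (rate_outP A j) => [[Au ->]|[i [Au iA -> _]]].
  have -> : (expR (J j * (1 + s) * N%:R) * beta =
     expR (J j * (1 + s) * N%:R) * error_bound alpha beta (j |: A)%SET j)%R.
    by rewrite /error_bound setU11.
  apply: (procedure_time_lower TD (L := fun n w => - lam j n w) (Bad := Bad)) => //.
  - move: PiA; rewrite /Pi_lu cardsU1 jA; case/andP => lA Au'.
    by rewrite (leq_trans lA)//= add1n ltn_neqAle Au' andbT; apply/eqP.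
  - by rewrite setU11 jA.
  - by move=> n n0; apply: measurableT_comp => //; exact: lam_measurable.
  - by move=> n y E n0 GE; exact: change_of_measure_add.
pose B := (A :\ i)%SET.
have iB : i \notin B by rewrite !inE eqxx.
have AE : A = (i |: B)%SET by rewrite finset.setD1K.
have cardA : #|A| = #|B|.+1 by rewrite AE cardsU1 iB.
have jB : j \notin B by rewrite !inE negb_and jA orbT.
have -> : (expR ((J j + I i) * (1 + s) * N%:R) * beta =
     expR ((J j + I i) * (1 + s) * N%:R) * error_bound alpha beta (j |: B)%SET j)%R.
  by rewrite /error_bound setU11.
apply: (procedure_time_lower TD (L := fun n w => lam i n w - lam j n w) (Bad := Bad)) => //.
- by move: PiA; rewrite /Pi_lu cardsU1 jB cardA.
- by rewrite setU11 jA.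
- by move=> n n0; apply: measurable_funB; exact: lam_measurable.
- by move=> n y E n0 GE; rewrite [in X in (X <= _)%E]AE; exact: change_of_measure_swap.
- move=> w n nB nN; have Hj := LBj w n nB nN.
  have := HBad w nB i n; rewrite /true_llr /rate iA => H.
  have Hi : lam i n w <= I i * (1 + s) * N%:R.
    by apply: bound_scale (H _) => //; case/andP: nN.
  by rewrite !mulrDl addrC lerD.
Qed.

(** * Upper bound for the proposed procedure *)

Lemma time_upper A k (B : nat -> set Omega) :
    (forall n, measurable (B n)) -> (\sum_(0 <= n <oo) P A (B n) < +oo)%E ->
  exists C : R, forall a b c d' N,
    (forall n, measurable [set w | hatT lam l u a b c d' k w = Some n]) ->
    (forall w n, (N <= n)%N -> ~ B n w ->
       cond1 lam l u a c k n.+1 w \/ cond2 lam l u b d' k n.+1 w) ->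
  (ET P A (hatT lam l u a b c d' k) <= (N.+1%:R + C)%:E)%E.
Proof.
move=> mB sumB.
have sum_fin : (\sum_(0 <= n <oo) P A (B n) \is a fin_num)%E.
  by rewrite ge0_fin_numE//; exact: nneseries_ge0.
(* This constant depends on [A] and [B] only, so it is fixed before the thresholds and [N]. *)
exists (fine (\sum_(0 <= n <oo) P A (B n))%E) => a b c d' N mT TB.
rewrite EFinD fineK//; apply: expected_time_upper => // w n Nn nB.
by apply: hatT_le => //; exact: TB.
Qed.

Let grow (r s : R) (t : R) (N n : nat) : 0 < r -> 0 < s < 1 -> (N <= n)%N ->
  t <= r * (1 - s) * N%:R -> t <= r * (1 - s) * n.+1%:R.
Proof.
move=> r0 /andP[_ s1] Nn /le_trans; apply.
by rewrite ler_pM2l ?mulr_gt0 ?subr_gt0// ler_nat ltnW.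
Qed.

Let rate_le (r r' s : R) (n : nat) : 0 < s < 1 -> r <= r' ->
  r * (1 - s) * n%:R <= r' * (1 - s) * n%:R.
Proof.
by move=> /andP[_ s1] rr'; rewrite ler_wpM2r// ler_wpM2r// subr_ge0 ltW.
Qed.

(** Off [B n] every ratio is above its line at time [n.+1]. If [#|A| = l], the gap between [i] and
    any [k \notin A] grows at least at rate [(I i + J k) * (1 - s)], and [J k] is at least the
    minimal [J j]. *)
Lemma time_upper_in A i (s : R) : Pi_lu l u A -> i \in A -> 0 < s < 1 ->
  exists C : R, forall a b c d' N,
    (forall n, measurable [set w | hatT lam l u a b c d' i w = Some n]) ->
    (if #|A| == l then c else a) <= rate_in A i * (1 - s) * N%:R ->
  (ET P A (hatT lam l u a b c d' i) <= (N.+1%:R + C)%:E)%E.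
Proof.
move=> PiA iA s01; have /andP[s0 s1] := s01.
have [B [mB sumB HB]] := true_llr_lower A s0.
have [C HC] := time_upper i mB sumB.
exists C => a b c d' N mT thr; apply: HC => // w n Nn nB; left.
have Hi := HB w n nB i; rewrite /rate /true_llr iA in Hi.
apply: (cond1_in lK PiA).
case: (rate_inP A i) thr => [[/eqP/negbTE -> ->]|[j [Al jA -> jmin]]].
  by move=> /(grow (I_gt0 i) s01 Nn) /le_trans; apply; exact: ltW.
rewrite Al eqxx => /(grow (addr_gt0 (I_gt0 i) (J_gt0 j)) s01 Nn) cN k kA.
have Hk := HB w n nB k; rewrite /rate /true_llr (negbTE kA) in Hk.
have := rate_le n.+1 s01 (jmin k kA).
move: cN; rewrite !mulrDl; lra.
Qed.

(** Mirror image: when [#|A| = u], the gaps [lam k - lam j] with [k \in A] must reach [d'], and the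
    smallest [I] governs them. *)
Lemma time_upper_out A j (s : R) : Pi_lu l u A -> j \notin A -> 0 < s < 1 ->
  exists C : R, forall a b c d' N,
    (forall n, measurable [set w | hatT lam l u a b c d' j w = Some n]) ->
    (if #|A| == u then d' else b) <= rate_out A j * (1 - s) * N%:R ->
  (ET P A (hatT lam l u a b c d' j) <= (N.+1%:R + C)%:E)%E.
Proof.
move=> PiA jA s01; have /andP[s0 s1] := s01.
have [B [mB sumB HB]] := true_llr_lower A s0.
have [C HC] := time_upper j mB sumB.
exists C => a b c d' N mT thr; apply: HC => // w n Nn nB; right.
have Hj := HB w n nB j; rewrite /rate /true_llr (negbTE jA) in Hj.
apply: (cond2_out u_gt0 PiA).
case: (rate_outP A j) thr => [[/eqP/negbTE -> ->]|[i [Au iA -> imin]]].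
  by move=> /(grow (J_gt0 j) s01 Nn) /le_trans; apply; exact: ltW.
rewrite Au eqxx => /(grow (addr_gt0 (J_gt0 j) (I_gt0 i)) s01 Nn) cN k kA.
have Hk := HB w n nB k; rewrite /rate /true_llr kA in Hk.
have := rate_le n.+1 s01 (imin k kA).
move: cN; rewrite !mulrDl; lra.
Qed.

(** * First-order optimality of the proposed procedure *)

Lemma rate_in_gt0 A i : 0 < rate_in A i.
Proof. by case: (rate_inP A i) => [[_ ->]|[j [_ _ -> _]]] //; exact: addr_gt0. Qed.

Lemma rate_out_gt0 A j : 0 < rate_out A j.
Proof. by case: (rate_outP A j) => [[_ ->]|[i [_ _ -> _]]] //; exact: addr_gt0. Qed.

Lemma Lopt_lower (A : {set 'I_K}) k (alpha beta y : R) :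
  (forall chi, Delta X P alpha beta (Pi_lu l u) chi -> (y%:E <= ET P A (chi.1 k))%E) ->
  (y%:E <= Lopt X P k A alpha beta (Pi_lu l u))%E.
Proof. by move=> H; apply/ereal_infP => _ [chi Dchi <-]; exact: H. Qed.

Variables a b c d' : R -> R -> R.
Let hT x y := hatT lam l u (a x y) (b x y) (c x y) (d' x y).
Let hD x y := hatD lam l u (a x y) (b x y) (c x y) (d' x y).
Hypothesis hat_Delta : forall x y : R, 0 < x < 1 -> 0 < y < 1 ->
  Delta X P x y (Pi_lu l u) (hT x y, hD x y).
Hypothesis a_sim : sim0 (fun x y => (a x y)%:E) (fun x y => `|ln x|).
Hypothesis c_sim : sim0 (fun x y => (c x y)%:E) (fun x y => `|ln x|).
Hypothesis b_sim : sim0 (fun x y => (b x y)%:E) (fun x y => `|ln y|).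
Hypothesis d_sim : sim0 (fun x y => (d' x y)%:E) (fun x y => `|ln y|).

Let hT_measurable x y k n : 0 < x < 1 -> 0 < y < 1 ->
  measurable [set w | hT x y k w = Some n].
Proof.
move=> x01 y01; have [/(_ k)[[_ GT] _ _ _] _] := hat_Delta x01 y01.
exact: (Fn_measurable mX (GT n)).
Qed.

Let Lopt_hat (A : {set 'I_K}) k x y : 0 < x < 1 -> 0 < y < 1 ->
  (Lopt X P k A x y (Pi_lu l u) <= ET P A (hT x y k))%E.
Proof.
by move=> x01 y01; apply: ereal_inf_lbound; exists (hT x y, hD x y) => //; exact: hat_Delta.
Qed.

Lemma sim0_in A i : Pi_lu l u A -> i \in A ->
  sim0 (fun x y => ET P A (hT x y i)) (fun x y => `|ln x| / rate_in A i) /\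
  sim0 (fun x y => Lopt X P i A x y (Pi_lu l u)) (fun x y => `|ln x| / rate_in A i).
Proof.
move=> PiA iA.
(* The threshold that controls stream [i] is [c] when [#|A| = l] and [a] otherwise; both are
   equivalent to [|ln x|]. *)
apply: (@sim0_of_bounds _ _ (fun x y => if #|A| == l then c x y else a x y)).
- exact: rate_in_gt0.
- move=> s eta s0 eta0; have [m Hm] := time_lower_in PiA iA s0 eta0.
  by exists m => N mN x y _ _; apply: Lopt_lower => chi; exact: Hm.
- move=> s s01; have [C HC] := time_upper_in PiA iA s01.
  by exists C => N x y x01 y01 thrN; apply: HC => // n; exact: hT_measurable.
- by move=> x y; exact: Lopt_hat.
- by case: (#|A| == l).
Qed.

Lemma sim0_out A j : Pi_lu l u A -> j \notin A ->
  sim0 (fun x y => ET P A (hT x y j)) (fun x y => `|ln y| / rate_out A j) /\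
  sim0 (fun x y => Lopt X P j A x y (Pi_lu l u)) (fun x y => `|ln y| / rate_out A j).
Proof.
move=> PiA jA.
(* Outside [A] the level [y] drives the growth, so [sim0_of_bounds] is applied with the two levels
   exchanged. *)
have [H1 H2] : sim0 (fun y x => ET P A (hT x y j)) (fun y x => `|ln y| / rate_out A j) /\
    sim0 (fun y x => Lopt X P j A x y (Pi_lu l u)) (fun y x => `|ln y| / rate_out A j).
  apply: (@sim0_of_bounds _ _ (fun y x => if #|A| == u then d' x y else b x y)).
  - exact: rate_out_gt0.
  - move=> s eta s0 eta0; have [m Hm] := time_lower_out PiA jA s0 eta0.
    by exists m => N mN y x _ _; apply: Lopt_lower => chi; exact: Hm.
  - move=> s s01; have [C HC] := time_upper_out PiA jA s01.
    by exists C => N y x y01 x01 thrN; apply: HC => // n; exact: hT_measurable.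
  - by move=> y x y01 x01; exact: Lopt_hat.
  - by case: (#|A| == u); [exact: sim0_swap d_sim|exact: sim0_swap b_sim].
by split; [exact: sim0_swap H1|exact: sim0_swap H2].
Qed.
End procedures.
End model.

Theorem theorem5p2
  (R : realType) (K : nat)
  (d : measure_display) (Omega : measurableType d)
  (dS : 'I_K -> measure_display) (S : forall k, measurableType (dS k))
  (X : forall k : 'I_K, nat -> Omega -> S k)
  (P : {set 'I_K} -> probability Omega R)
  (lam : 'I_K -> nat -> Omega -> R)
  (I J : 'I_K -> R)
  (l u : nat)
  (a b c d' : R -> R -> R) :
  (* K >= 1, 0 <= l <= u <= K, u > 0, l < K *)
  (1 <= K)%N -> (l <= u <= K)%N -> (0 < u)%N -> (l < K)%N ->
  (* observations are random elements *)
  (forall k t, measurable_fun setT (X k t)) ->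
  (* under P_A the streams are independent ... *)
  (forall (A : {set 'I_K}) (E : 'I_K -> set Omega),
      (forall k, Fk_inf X k (E k)) ->
      P A (\bigcap_k E k) = (\prod_(k : 'I_K) P A (E k))%E) ->
  (* ... and X_k ~ P_k^1 (= its law under P_{k}) if k in A, X_k ~ P_k^0 (= its law under P_emptyset) otherwise *)
  (forall (A : {set 'I_K}) (k : 'I_K) (E : set Omega), Fk_inf X k E ->
      P A E = if k \in A then P (sing k) E else P emptyK E) ->
  (* lam k n = log dP_k^1/dP_k^0 restricted to F_k(n), n in N *)
  (forall (k : 'I_K) (n : nat), (0 < n)%N ->
      (forall B : set R, measurable B -> Fk X k n (lam k n @^-1` B)) /\
      (forall E, Fk X k n E ->
         P (sing k) E = (\int[P emptyK]_(w in E) (expR (lam k n w))%:E)%E)) ->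
  (* rates I_k, J_k > 0 *)
  (forall k, 0 < I k) -> (forall k, 0 < J k) ->
  (forall k, P (sing k) [set w | (limn_esup (fun n => (lam k n.+1 w / n.+1%:R)%:E)
                                  <= (I k)%:E)%E] = 1%E) ->
  (forall k, P emptyK [set w | (limn_esup (fun n => (- lam k n.+1 w / n.+1%:R)%:E)
                                  <= (J k)%:E)%E] = 1%E) ->
  (forall k (eps : R), 0 < eps ->
      (\sum_(0 <= n <oo) P (sing k) [set w | (lam k n.+1 w / n.+1%:R <= I k - eps)%R] < +oo)%E) ->
  (forall k (eps : R), 0 < eps ->
      (\sum_(0 <= n <oo) P emptyK [set w | (- lam k n.+1 w / n.+1%:R <= J k - eps)%R] < +oo)%E) ->
  (* thresholds: positive, and chosen so that hat chi is in Delta(alpha, beta, Pi_{l,u}) *)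
  (forall alpha beta : R, 0 < alpha < 1 -> 0 < beta < 1 ->
      [/\ 0 < a alpha beta, 0 < b alpha beta, 0 < c alpha beta & 0 < d' alpha beta]) ->
  (forall alpha beta : R, 0 < alpha < 1 -> 0 < beta < 1 ->
      Delta X P alpha beta (Pi_lu l u)
        (hatT lam l u (a alpha beta) (b alpha beta) (c alpha beta) (d' alpha beta),
         hatD lam l u (a alpha beta) (b alpha beta) (c alpha beta) (d' alpha beta))) ->
  (* a, c ~ |log alpha| and b, d ~ |log beta| *)
  sim0 (fun alpha beta => (a alpha beta)%:E) (fun alpha beta => `|ln alpha|) ->
  sim0 (fun alpha beta => (c alpha beta)%:E) (fun alpha beta => `|ln alpha|) ->
  sim0 (fun alpha beta => (b alpha beta)%:E) (fun alpha beta => `|ln beta|) ->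
  sim0 (fun alpha beta => (d' alpha beta)%:E) (fun alpha beta => `|ln beta|) ->
  forall A : {set 'I_K}, Pi_lu l u A ->
    (forall i : 'I_K, i \in A ->
       let g := fun alpha beta : R =>
         `|ln alpha| / (I i + (if #|A| == l then fine (calJ J A) else 0)) in
       sim0 (fun alpha beta => ET P A
              (hatT lam l u (a alpha beta) (b alpha beta) (c alpha beta) (d' alpha beta) i)) g /\
       sim0 (fun alpha beta => Lopt X P i A alpha beta (Pi_lu l u)) g) /\
    (forall j : 'I_K, j \notin A ->
       let g := fun alpha beta : R =>
         `|ln beta| / (J j + (if #|A| == u then fine (calI I A) else 0)) in
       sim0 (fun alpha beta => ET P A
              (hatT lam l u (a alpha beta) (b alpha beta) (c alpha beta) (d' alpha beta) j)) g /\
       sim0 (fun alpha beta => Lopt X P j A alpha beta (Pi_lu l u)) g).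
Proof.
move=> _ _ u0 lK mX indep marg llr I0 J0 ls1 ls0 cc1 cc0 _ hat a_sim c_sim b_sim d_sim A PiA.
split=> [i iA|j jA] /=.
- exact: (sim0_in mX indep marg llr I0 J0 ls1 ls0 cc1 cc0 lK hat a_sim c_sim PiA iA).
- exact: (sim0_out mX indep marg llr I0 J0 ls1 ls0 cc1 cc0 u0 hat b_sim d_sim PiA jA).
Qed.
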